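(* The fair liveness verification problem for broadcast networks is in $\mathsf{P}$: given a broadcast network $\mathcal{N}=(D,P)$ with client $P=(Q,I,\delta)$ and a set $F\subseteq Q$ of final states, it can be decided in polynomial time whether there exists an infinite initialized computation $\pi$ of $\mathcal{N}$ with $\mathrm{Inf}(\pi)\subseteq\mathrm{Fin}(\pi)$.
   Context: A broadcast network is a pair $\mathcal{N}=(D,P)$ where $D$ is a finite set of messages and $P=(Q,I,\delta)$ is a finite automaton with initial states $I$ and $\delta\subseteq Q\times\mathrm{Ops}(D)\times Q$, $\mathrm{Ops}(D)=\{!a,\ ?a: a\in D\}$; write $q\xrightarrow{o}q'$ for $(q,o,q')\in\delta$. A configuration is $c\in Q^k$ for some $k$, with entries $c[i]$; initial configurations are those in $\bigcup_k I^k$. For $c,c'\in Q^k$ and $a\in D$, $c\xrightarrow{a}c'$ holds if there is $i$ with $c[i]\xrightarrow{!a}c'[i]$, a set $R\subseteq[1..k]\setminus\{i\}$ with $c[j]\xrightarrow{?a}c'[j]$ for $j\in R$, and $c[j]=c'[j]$ for $j\notin R\cup\{i\}$; then $\mathrm{type}(c\xrightarrow{a}c')=R\cup\{i\}$. An infinite computation $\pi=c_0\to c_1\to\cdots$ is initialized if $c_0$ is initial. $\mathrm{Inf}(\pi)=\{i: i\in\mathrm{type}(c_j\to c_{j+1})\text{ for infinitely many } j\}$ and $\mathrm{Fin}(\pi)=\{i: c_j[i]\in F\text{ for infinitely many } j\}$. *)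

(* Defs.v *)
From mathcomp Require Import all_boot.
Set Implicit Arguments. Unset Strict Implicit. Unset Printing Implicit Defensive.

Inductive op (D : Type) : Type := Send of D | Recv of D.

Definition bstep (Q D : Type) (delta : Q -> op D -> Q -> Prop) (k : nat)
  (c c' : 'I_k -> Q) (a : D) (T : {set 'I_k}) : Prop :=
  exists i : 'I_k,
    [/\ i \in T,
        delta (c i) (Send a) (c' i),
        (forall j, j \in T -> j != i -> delta (c j) (Recv a) (c' j)) &
        (forall j, j \notin T -> c j = c' j)].

Definition fair_computation_exists (Q D : Type) (init : Q -> Prop)
  (delta : Q -> op D -> Q -> Prop) (fin : Q -> Prop) : Prop :=
  exists (k : nat) (cfg : nat -> 'I_k -> Q) (msg : nat -> D)
         (typ : nat -> {set 'I_k}),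
    [/\ (forall i, init (cfg 0 i)),
        (forall j, bstep delta (cfg j) (cfg j.+1) (msg j) (typ j)) &
        (forall i : 'I_k,
           (forall N, exists2 j, N <= j & i \in typ j) ->
           (forall N, exists2 j, N <= j & fin (cfg j i)))].

(* A broadcast network with states Q = {0..nQ-1}, messages D = {0..nD-1},
   initial states binit, transitions bdelta given as (q, is_send, a, q')
   (is_send = true for q --!a--> q', false for q --?a--> q'),
   and final states bfin. *)
Record instance := Instance {
  nQ : nat; nD : nat;
  binit : seq nat;
  bdelta : seq (nat * bool * nat * nat);
  bfin : seq nat }.

Definition wf_instance (N : instance) : bool :=
  [&& all (fun q => q < nQ N) (binit N),
      all (fun q => q < nQ N) (bfin N) &
      all (fun t => let: (q, _, a, q') := t in
                    [&& q < nQ N, a < nD N & q' < nQ N]) (bdelta N)].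

Definition inst_delta (N : instance) (q : nat) (o : op nat) (q' : nat) : Prop :=
  match o with
  | Send a => (q, true, a, q') \in bdelta N
  | Recv a => (q, false, a, q') \in bdelta N
  end.

Definition fair_live (N : instance) : Prop :=
  fair_computation_exists (fun q => q \in binit N) (inst_delta N)
                          (fun q => q \in bfin N).

(* Unary, self-delimiting: n ↦ 1^n 0.  Since every index is < nQ or < nD and
   nQ, nD are written in unary, this is polynomially equivalent to the explicit
   listing of Q, D, I, δ, F. *)
Definition enc_nat (n : nat) : seq bool := rcons (nseq n true) false.
Definition enc_list (T : Type) (e : T -> seq bool) (s : seq T) : seq bool :=
  enc_nat (size s) ++ flatten (map e s).
Definition enc_trans (t : nat * bool * nat * nat) : seq bool :=
  let: (q, b, a, q') := t in enc_nat q ++ [:: b] ++ enc_nat a ++ enc_nat q'.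
Definition enc_instance (N : instance) : seq bool :=
  enc_nat (nQ N) ++ enc_nat (nD N) ++ enc_list enc_nat (binit N)
  ++ enc_list enc_trans (bdelta N) ++ enc_list enc_nat (bfin N).

(* Tape alphabet: option bool (None = blank); bi-infinite tape. *)
Record TM := MkTM {
  tm_nstates : nat;
  tm_start : 'I_tm_nstates;
  tm_acc : 'I_tm_nstates;
  tm_rej : 'I_tm_nstates;
  (* next state, written symbol, move (true = right, false = left) *)
  tm_trans : 'I_tm_nstates -> option bool -> 'I_tm_nstates * option bool * bool }.

Record tm_config (M : TM) := TMConfig {
  cf_state : 'I_(tm_nstates M);
  cf_left : seq (option bool);   (* cells left of the head, nearest first *)
  cf_head : option bool;
  cf_right : seq (option bool) }. (* cells right of the head, nearest first *)

Definition tm_halted (M : TM) (c : tm_config M) : bool :=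
  (cf_state c == tm_acc M) || (cf_state c == tm_rej M).

Definition tm_step (M : TM) (c : tm_config M) : tm_config M :=
  if tm_halted c then c else
  let: (s', w, mv) := tm_trans (cf_state c) (cf_head c) in
  if mv then
    match cf_right c with
    | [::] => TMConfig s' (w :: cf_left c) None [::]
    | x :: r => TMConfig s' (w :: cf_left c) x r
    end
  else
    match cf_left c with
    | [::] => TMConfig s' [::] None (w :: cf_right c)
    | x :: l => TMConfig s' l x (w :: cf_right c)
    end.

Definition tm_init (M : TM) (x : seq bool) : tm_config M :=
  match x with
  | [::] => TMConfig (tm_start M) [::] None [::]
  | b :: r => TMConfig (tm_start M) [::] (Some b) (map Some r)
  end.

Definition tm_state_after (M : TM) (t : nat) (x : seq bool) : 'I_(tm_nstates M) :=
  cf_state (iter t (@tm_step M) (tm_init M x)).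

Definition poly_time_decidable (L : instance -> Prop) : Prop :=
  exists (M : TM) (c e : nat),
    tm_acc M != tm_rej M /\
    forall N : instance, wf_instance N ->
      let x := enc_instance N in
      let t := c * (size x).+1 ^ e in
      tm_halted (iter t (@tm_step M) (tm_init M x)) /\
      (tm_state_after M t x == tm_acc M <-> L N).

(* Main.v *)
From HB Require Import structures.
Require Import Defs.
From mathcomp Require Import all_boot zify.
From Stdlib Require Import Classical ClassicalEpsilon.
Set Implicit Arguments. Unset Strict Implicit. Unset Printing Implicit Defensive.

(** Fairness asks every client that moves infinitely often to visit a final
    state infinitely often, so the set of transitions that some client takes
    infinitely often is a set E with: every source is reachable, every receive
    in E has a send of the same message in E, and every transition of E lies on
    a closed E-walk through a final state.  Conversely, put one client on every
    position of every such closed walk and let all of them advance in lockstep: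
    in each round the receivers of a message are served by its first sender,
    and every client keeps cycling through a final state.  Any finite family of
    reachable states is covered by running disjoint populations one after the
    other.

    Hence fair liveness holds iff the greatest such E is nonempty, and the
    greatest E is found by pruning.  The pruning is a program over numbers
    (read as positions in the input) and sets of positions; a Turing machine
    keeps this store on its tape as one block of bits per input position and
    executes each instruction in a single sweep over the tape. *)

(** * Machines over a finite state type *)

(** The closed walks may have different lengths, and all their shifts are populated so that every
    transition of E is taken by some client in every round. A scheduled receive therefore finds the
    send that E provides for it scheduled in the same round. Goodness of a transition is monotone in
    the set, so the order of pruning is immaterial and no live set is ever damaged. Numbers are
    unary in the input: a state, a message or the index of a transition is smaller than the input
    length, hence is a tape position, and a set of them is one bit per position. A pointer is a set
    with one element, and incrementing it shifts a mark by one block. Thus every instruction acts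
    inside a block, up to one bit handed from a block to the next; no pointer arithmetic or
    comparison is needed. Since the alphabet is only bits and blank, the bits of all pointers and
    sets at a position lie side by side in a block of constant width, and the offset within the
    block is kept in the machine state. *)

Definition goes (A : Type) (f : A -> A) (t : nat) (x y : A) : Prop :=
  exists2 k, k <= t & iter k f x = y.

Lemma goes_refl A (f : A -> A) t x : goes f t x x.
Proof. by exists 0. Qed.

Lemma goes_trans A (f : A -> A) t1 t2 x y z :
  goes f t1 x y -> goes f t2 y z -> goes f (t1 + t2) x z.
Proof.
move=> [k1 h1 <-] [k2 h2 <-]; exists (k2 + k1); last by rewrite iterD.
by rewrite addnC leq_add.
Qed.

Lemma goes_le A (f : A -> A) t1 t2 x y :
  t1 <= t2 -> goes f t1 x y -> goes f t2 x y.
Proof. by move=> h [k hk e]; exists k => //; apply: leq_trans h. Qed.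

Section FiniteStateMachine.
Variables (St : finType) (start acc rej : St).
Variable delta : St -> option bool -> St * option bool * bool.

Definition machine : TM :=
  MkTM (enum_rank start) (enum_rank acc) (enum_rank rej)
    (fun s a => let: (s', w, mv) := delta (enum_val s) a in
                (enum_rank s', w, mv)).

(* [t] lists the scanned cell and the cells to its right. *)
Definition config (s : St) (l t : seq (option bool)) : tm_config machine :=
  @TMConfig machine (enum_rank s) l (head None t) (behead t).

(** The result of a left move: the head is on the nearest cell of [l], or on a fresh blank if [l] is
    empty. Leftward scans can so be proved by the same induction as rightward ones. *)
Definition config_left (s : St) (l t : seq (option bool)) : tm_config machine :=
  config s (behead l) (head None l :: t).

Notation step := (@tm_step machine).

Lemma halted_config s l t : tm_halted (config s l t) = (s == acc) || (s == rej).
Proof. by rewrite /tm_halted /= !(inj_eq enum_rank_inj). Qed.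

Lemma step_right s l t s' w :
  s != acc -> s != rej -> delta s (head None t) = (s', w, true) ->
  step (config s l t) = config s' (w :: l) (behead t).
Proof.
move=> h1 h2 e; rewrite /tm_step halted_config (negbTE h1) (negbTE h2) /=.
by rewrite enum_rankK e; case: (behead t).
Qed.

Lemma step_left s l t s' w :
  s != acc -> s != rej -> delta s (head None t) = (s', w, false) ->
  step (config s l t) = config_left s' l (w :: behead t).
Proof.
move=> h1 h2 e; rewrite /tm_step halted_config (negbTE h1) (negbTE h2) /=.
by rewrite enum_rankK e; case: l.
Qed.

Lemma scan_right s w l t :
  s != acc -> s != rej ->
  (forall b, delta s (Some b) = (s, Some b, true)) ->
  goes step (size w) (config s l (map Some w ++ t))
                     (config s (rev (map Some w) ++ l) t).
Proof.
move=> h1 h2 h; elim: w l => [|b w IH] l; first exact: goes_refl.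
apply: (@goes_trans _ _ 1 _ _ (config s (Some b :: l) (map Some w ++ t))).
  by exists 1 => //; apply: step_right => //; apply: h.
by rewrite /= rev_cons cat_rcons.
Qed.

Lemma scan_left s w l t :
  s != acc -> s != rej ->
  (forall b, delta s (Some b) = (s, Some b, false)) ->
  goes step (size w) (config_left s (map Some w ++ l) t)
                     (config_left s l (rev (map Some w) ++ t)).
Proof.
move=> h1 h2 h; elim: w t => [|b w IH] t; first exact: goes_refl.
apply: (@goes_trans _ _ 1 _ _ (config_left s (map Some w ++ l) (Some b :: t))).
  by exists 1 => //; apply: step_left => //; apply: h.
by rewrite /= rev_cons cat_rcons.
Qed.

End FiniteStateMachine.

(** * The programming language *)

(* On the tape, pointer [v] is the set of positions [j] with [j == ptr s v]. *)
Record store := Store { ptr : nat -> nat; trk : nat -> nat -> bool }.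

Variant instr :=
  | Zero of nat
  | Incr of nat
  | Copy of nat & nat
  | Clear of nat
  | Put of nat & nat & bool
  | Meet of nat & nat
  | Look of nat & nat.

Definition upd (A : Type) (f : nat -> A) (u : nat) (a : A) (v : nat) : A :=
  if v == u then a else f v.

Definition set_ptr s u x := Store (upd (ptr s) u x) (trk s).
Definition set_trk s k A := Store (ptr s) (upd (trk s) k A).

Definition eff (i : instr) (s : store) : store :=
  match i with
  | Zero u => set_ptr s u 0
  | Incr u => set_ptr s u (ptr s u).+1
  | Copy u w => set_ptr s u (ptr s w)
  | Clear k => set_trk s k (fun=> false)
  | Put k w b => set_trk s k (upd (trk s k) (ptr s w) b)
  | Meet k l => set_trk s k (fun j => trk s k j && trk s l j)
  | Look _ _ => s
  end.

(* A pointer that has run off the tape has no mark in any block. *)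
Definition look (n : nat) (s : store) (k w : nat) : bool :=
  (ptr s w < n) && trk s k (ptr s w).

Definition res (n : nat) (i : instr) (s : store) : bool :=
  if i is Look k w then look n s k w else false.

Inductive cmd :=
  | Do of instr
  | Seq of cmd & cmd
  | If of nat & nat & cmd & cmd
  | While of nat & nat & cmd.

Inductive ex (n : nat) : cmd -> store -> nat -> store -> Prop :=
  | ExDo i s : ex n (Do i) s 1 (eff i s)
  | ExSeq c1 c2 s s1 s2 t1 t2 :
      ex n c1 s t1 s1 -> ex n c2 s1 t2 s2 -> ex n (Seq c1 c2) s (t1 + t2) s2
  | ExIfT k w c1 c2 s s' t :
      look n s k w -> ex n c1 s t s' -> ex n (If k w c1 c2) s t.+1 s'
  | ExIfF k w c1 c2 s s' t :
      ~~ look n s k w -> ex n c2 s t s' -> ex n (If k w c1 c2) s t.+1 s'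
  | ExWhileF k w c s : ~~ look n s k w -> ex n (While k w c) s 1 s
  | ExWhileT k w c s s1 s2 t1 t2 :
      look n s k w -> ex n c s t1 s1 -> ex n (While k w c) s1 t2 s2 ->
      ex n (While k w c) s (t1 + t2).+1 s2.

(** The values of the program counter: one for each instruction and test of [c]. In [If] and [While]
    the test is [None]. *)
Fixpoint ctl (c : cmd) : finType :=
  match c with
  | Do _ => unit
  | Seq c1 c2 => (ctl c1 + ctl c2)%type
  | If _ _ c1 c2 => option (ctl c1 + ctl c2)
  | While _ _ c1 => option (ctl c1)
  end.

Fixpoint entry (c : cmd) : ctl c :=
  match c return ctl c with
  | Do _ => tt
  | Seq c1 c2 => inl (entry c1)
  | If _ _ c1 c2 => None
  | While _ _ c1 => None
  end.

Fixpoint code (c : cmd) : ctl c -> instr :=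
  match c return ctl c -> instr with
  | Do i => fun=> i
  | Seq c1 c2 => fun x => match x with inl y => code y | inr y => code y end
  | If k w c1 c2 => fun x => match x with
      | None => Look k w | Some (inl y) => code y | Some (inr y) => code y end
  | While k w c1 => fun x => if x is Some y then code y else Look k w
  end.

Fixpoint follow (c : cmd) : ctl c -> bool -> option (ctl c) :=
  match c return ctl c -> bool -> option (ctl c) with
  | Do i => fun _ _ => None
  | Seq c1 c2 => fun x b => match x with
      | inl y => Some (if follow y b is Some z then inl z else inr (entry c2))
      | inr y => omap inr (follow y b) end
  | If k w c1 c2 => fun x b => match x with
      | None => Some (Some (if b then inl (entry c1) else inr (entry c2)))
      | Some (inl y) => omap (fun z => Some (inl z)) (follow y b)
      | Some (inr y) => omap (fun z => Some (inr z)) (follow y b) end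
  | While k w c1 => fun x b => match x with
      | None => if b then Some (Some (entry c1)) else None
      (* On leaving the body [follow y b] is [None], which is also the control point of the test. *)
      | Some y => Some (follow y b) end
  end.

(** Execution by control points, the form that the machine simulates sweep by sweep. The final
    boolean is the answer of the last instruction and becomes the verdict in [Halt]. *)
Inductive runs (n : nat) (c : cmd) : ctl c -> store -> nat -> store -> bool -> Prop :=
  | RunEnd x s : follow x (res n (code x) s) = None ->
      runs n x s 1 (eff (code x) s) (res n (code x) s)
  | RunStep x y s t s' b : follow x (res n (code x) s) = Some y ->
      runs n y (eff (code x) s) t s' b -> runs n x s t.+1 s' b.

Section Lifting.
Variables (n : nat) (c c' : cmd) (f : ctl c -> ctl c').
Hypothesis code_f : forall x, code (f x) = code x.

Lemma runs_tail (x : ctl c) s t s' b :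
  (forall x b, follow (f x) b = omap f (follow x b)) ->
  runs n x s t s' b -> runs n (f x) s t s' b.
Proof.
move=> hn; elim=> {x s t s' b} [x s h|x y s t s' b h _ IH].
  by rewrite -code_f; apply: RunEnd; rewrite code_f hn h.
by apply: (@RunStep n _ _ (f y)); rewrite code_f // hn h.
Qed.

(** For a subprogram whose end resumes at [z]: the second command of a sequence, or the test of the
    enclosing loop. *)
Lemma runs_jump (x : ctl c) z s t s1 b1 t2 s' b :
  (forall x b, follow (f x) b = Some (oapp f z (follow x b))) ->
  runs n x s t s1 b1 -> runs n z s1 t2 s' b -> runs n (f x) s (t + t2) s' b.
Proof.
move=> hn; elim=> {x s t s1 b1} [x s h|x y s t s1 b1 h _ IH] r.
  by rewrite add1n; apply: (@RunStep n _ _ z); rewrite code_f // hn h.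
by rewrite addSn; apply: (@RunStep n _ _ (f y)); rewrite code_f ?hn ?h //; apply: IH.
Qed.
End Lifting.

Lemma ex_runs n c s t s' : ex n c s t s' -> exists b, runs n (entry c) s t s' b.
Proof.
elim=> {c s t s'}.
- by move=> i s; exists (res n i s); apply: (@RunEnd n (Do i) tt).
- move=> c1 c2 s s1 s2 t1 t2 _ [b1 r1] _ [b2 r2]; exists b2.
  apply: (@runs_jump n c1 (Seq c1 c2) inl _ _ (inr (entry c2)) _ _ _ _ _ _ _ _ r1) =>
    //.
  by apply: (@runs_tail n c2 (Seq c1 c2) inr) r2.
- move=> k w c1 c2 s s' t hl _ [b r]; exists b.
  apply: (@RunStep n (If k w c1 c2) None (Some (inl (entry c1)))); rewrite /= ?hl //.
  by apply: (@runs_tail n c1 (If k w c1 c2) (fun z => Some (inl z))) r.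
- move=> k w c1 c2 s s' t hl _ [b r]; exists b.
  apply: (@RunStep n (If k w c1 c2) None (Some (inr (entry c2)))); rewrite /=
    ?(negbTE hl) //.
  by apply: (@runs_tail n c2 (If k w c1 c2) (fun z => Some (inr z))) r.
- move=> k w c s hl; exists (look n s k w).
  by apply: (@RunEnd n (While k w c) None); rewrite /= (negbTE hl).
- move=> k w c s s1 s2 t1 t2 hl _ [b1 r1] _ [b2 r2]; exists b2.
  apply: (@RunStep n (While k w c) None (Some (entry c))); rewrite /= ?hl //.
  apply: (@runs_jump n c (While k w c) Some _ _ None _ _ _ _ _ _ _ _ r1) => //.
  by move=> x b /=; case: (follow x b).
Qed.

(** [ex_runs] leaves the last answer unspecified; one appended instruction determines it, so a
    program can return a verdict. *)
Lemma runs_seq_do n c i s t s' : ex n c s t s' ->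
  runs n (entry (Seq c (Do i))) s (t + 1) (eff i s') (res n i s').
Proof.
move=> /ex_runs [b1 r1].
apply: (@runs_jump n c (Seq c (Do i)) inl _ _ (inr tt) _ _ _ _ _ _ _ _ r1) => //.
by apply: (@RunEnd n (Seq c (Do i)) (inr tt)).
Qed.

(** * Instructions as tape sweeps *)

(* A sweep runs through each block from left to right and rewrites the bit at
   [target i], given the bit read earlier at [latch i] and a bit carried along
   from block to block. *)
Definition latch (i : instr) : nat :=
  match i with
  | Zero _ | Incr _ | Clear _ => 0
  | Copy _ w | Put _ w _ | Meet _ w | Look _ w => w
  end.

Definition target (i : instr) : nat :=
  match i with
  | Zero u | Incr u | Copy u _ | Clear u | Put u _ _ | Meet u _ | Look u _ => u
  end.

Definition carry0 (i : instr) : bool := if i is Zero _ then true else false.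

(** The result is the new carried bit and the new target bit. [Zero] enters with a carried one and
    drops it in block 0; [Incr] exchanges the carried bit with the target bit, which moves the mark
    one block to the right; [Look] accumulates a disjunction. *)
Definition act (i : instr) (m d b : bool) : bool * bool :=
  match i with
  | Zero _ => (false, m)
  | Incr _ => (b, m)
  | Copy _ _ => (m, d)
  | Clear _ => (m, false)
  | Put _ _ c => (m, if d then c else b)
  | Meet _ _ => (m, b && d)
  | Look _ _ => (m || b && d, b)
  end.

Definition trans (i : instr) (v : nat) (m d b : bool) : bool * bool * bool :=
  if v == target i then let: (m', b') := act i m d b in (m', d, b')
  else if v == latch i then (m, b, b) else (m, d, b).

Definition is_look (i : instr) : bool := if i is Look _ _ then true else false.

Section Blocks.
Variables (np w : nat).

Definition wf_instr (i : instr) : bool :=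
  (latch i < target i) &&
  match i with
  | Zero u | Incr u | Copy u _ => u < np
  | Clear k => np <= k < w
  | Put k u _ | Look k u => (u < np) && (np <= k < w)
  | Meet k l => (np <= l) && (k < w)
  end.

Fixpoint wf_cmd (c : cmd) : bool :=
  match c with
  | Do i => wf_instr i
  | Seq c1 c2 => wf_cmd c1 && wf_cmd c2
  | If k u c1 c2 => [&& wf_instr (Look k u), wf_cmd c1 & wf_cmd c2]
  | While k u c1 => wf_instr (Look k u) && wf_cmd c1
  end.

Lemma wf_code c (x : ctl c) : wf_cmd c -> wf_instr (code x).
Proof.
elim: c x => //=.
- by move=> c1 h1 c2 h2 [x|x] /andP[] => [/h1|_ /h2].
- by move=> k u c1 h1 c2 h2 [[x|x]|] /and3P[] // => _ => [/h1|_ /h2].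
- by move=> k u c1 h1 [x|] /andP[] // _ /h1.
Qed.

Definition bit (s : store) (j v : nat) : bool :=
  if v < np then j == ptr s v else trk s v j.
Definition block (s : store) (j : nat) : seq bool := mkseq (bit s j) w.
Definition blocks (s : store) (n : nat) : seq bool :=
  flatten (mkseq (block s) n).

Lemma size_blocks s n : size (blocks s n) = n * w.
Proof.
elim: n => [|n IH] //; rewrite /blocks mkseqS -cats1 flatten_cat size_cat IH /=.
by rewrite cats0 size_mkseq mulSn addnC.
Qed.

Fixpoint sweep (i : instr) (v : nat) (m d : bool) (bs : seq bool) : bool * bool * seq
  bool :=
  if bs is b :: bs' then
    let: (m1, d1, b1) := trans i v m d b in
    let: (m2, d2, bs2) := sweep i (v.+1 %% w) m1 d1 bs' in
    (m2, d2, b1 :: bs2)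
  else (m, d, [::]).

Lemma sweep_cat i v m d bs1 bs2 : v < w ->
  sweep i v m d (bs1 ++ bs2) =
  let: (m1, d1, r1) := sweep i v m d bs1 in
  let: (m2, d2, r2) := sweep i ((v + size bs1) %% w) m1 d1 bs2 in
  (m2, d2, r1 ++ r2).
Proof.
elim: bs1 v m d => [|b bs IH] v m d hv /=.
  by rewrite addn0 modn_small //; case: (sweep _ _ _ _ _) => [[]].
case: (trans _ _ _ _ _) => [[m1 d1] b1]; rewrite IH ?ltn_mod ?(leq_trans _ hv) //.
case: (sweep _ _ _ _ bs) => [[m2 d2] r2].
rewrite modnDml addSnnS.
by case: (sweep _ _ _ _ bs2) => [[]].
Qed.

(** The latched bit has to be correct only past the latch, and the target comes later. At the start
    of a block [d] may thus be left over from the previous block, and nothing is claimed about the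
    outgoing [d']. *)
Lemma sweep_iota i (f : nat -> bool) v c m d : v + c <= w ->
  latch i < target i < w ->
  (latch i < v -> d = f (latch i)) ->
  exists d',
  sweep i v m d (map f (iota v c)) =
  let p := act i m (f (latch i)) (f (target i)) in
  (if v <= target i < v + c then p.1 else m, d',
   map (fun u => if u == target i then p.2 else f u) (iota v c)).
Proof.
move=> + /andP[hl ht].
elim: c v m d => [|c IH] v m d hv hd /=.
  by exists d; rewrite addn0 [_ <= _ < _]andbC ltnNge andNb.
have hsw m1 d1 : sweep i (v.+1 %% w) m1 d1 (map f (iota v.+1 c)) = sweep i v.+1 m1 d1
  (map f (iota v.+1 c)).
  case: c hv {IH} => [|c] hv; first by [].
  by rewrite modn_small //; lia.
rewrite /trans.
have [ev|nv] := eqVneq v (target i).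
  rewrite hd ?ev // -ev.
  case ea: (act _ _ _ _) => [m' b']; rewrite hsw.
  case: (IH v.+1 m' (f (latch i))); [lia|by [] |].
  move=> d' ->; exists d'; rewrite -ev /= ltnn andFb leqnn /=.
  have -> : v < v + c.+1 by lia.
  congr (_, _, _ :: _); apply/eq_in_map => u; rewrite mem_iota => /andP[hu _].
  by rewrite gtn_eqF.
set d1 := if v == latch i then f v else d.
have -> : (if v == latch i then (m, f v, f v) else (m, d, f v)) = (m, d1, f v).
  by rewrite /d1; case: eqP.
rewrite hsw; case: (IH v.+1 m d1); first lia.
  rewrite /d1 ltnS leq_eqVlt eq_sym; case: eqP => [->//|_] /=; exact: hd.
move=> d' ->; exists d' => /=.
have -> : (v < target i < v.+1 + c) = (v <= target i < v + c.+1) by lia.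
by [].
Qed.

Definition eff_bit (i : instr) (s : store) (j : nat) (m : bool) (v : nat) : bool :=
  if v == target i then (act i m (bit s j (latch i)) (bit s j (target i))).2
  else bit s j v.

(** The bit carried into block [j]. For [Look], at [j] equal to the number of blocks, it is the
    answer of the test. *)
Definition carry (i : instr) (s : store) (j : nat) : bool :=
  match i with
  | Zero _ => j == 0
  | Incr u => j == (ptr s u).+1
  | Look k u => (ptr s u < j) && trk s k (ptr s u)
  | _ => false
  end.

Lemma carry_step i s j : wf_instr i ->
  (act i (carry i s j) (bit s j (latch i)) (bit s j (target i))).1 = carry i s j.+1.
Proof.
case: i => //= [u|k u] /andP[h1 h2].
  by rewrite /bit h2 eqSS.
case/andP: h2 => hu /andP[hk _].
rewrite /bit hu (ltnNge k) hk /= ltnS [in RHS]leq_eqVlt andb_orl orbC eq_sym.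
by congr (_ || _); case: eqP => [->|_]; rewrite ?andbT ?andbF.
Qed.

Lemma act_bit i s j v : wf_instr i -> v < w ->
  eff_bit i s j (carry i s j) v = bit (eff i s) j v.
Proof.
move=> hi hv; rewrite /eff_bit; case: eqVneq => [->|hne]; last first.
  case: i hi hne => //= [u|u|u u'|k|k u c|k l] hi /negbTE hne;
    by rewrite /bit /= /upd hne.
case: i hi => //= [u|u|u u'|k|k u c|k l] /andP[/= h1 h2].
- by rewrite /bit h2 /= /upd eqxx.
- by rewrite /bit h2 /= /upd eqxx.
- by rewrite /bit h2 (ltn_trans h1 h2) /= /upd eqxx.
- by case/andP: h2 => h2 _; rewrite /bit (ltnNge k) h2 /= /upd eqxx.
- by case/and3P: h2 => hu hk _; rewrite /bit hu (ltnNge k) hk /= /upd eqxx.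
- by case/andP: h2 => hl hk; rewrite /bit (ltnNge k) (ltnNge l) hl (leq_trans hl
    (ltnW h1)) /= /upd eqxx.
Qed.

Lemma sweep_blocks i s n : np <= w -> wf_instr i ->
  exists d, sweep i 0 (carry0 i) false (blocks s n) = (carry i s n, d, blocks (eff i
    s) n).
Proof.
move=> hnp hi.
have htw : target i < w.
  by case/andP: hi => _; case: (i) => //= *; lia.
have hlt : latch i < target i < w by rewrite htw andbT; case/andP: hi.
have w0 : 0 < w by lia.
elim: n => [|n [d IH]].
  by exists false; congr (_, _, _); case: (i).
rewrite /blocks !mkseqS -!cats1 !flatten_cat /= !cats0 sweep_cat //.
rewrite -[flatten _]/(blocks s n) IH add0n.
have -> : size (blocks s n) %% w = 0.
  by rewrite size_blocks modnMl.
rewrite /block /mkseq.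
have [d' ->] := @sweep_iota i (bit s n) 0 w (carry i s n) d (leqnn w) hlt (fun h =>
  ltac:(by [])).
exists d'; congr (_, _, _ ++ _).
  by rewrite add0n htw /= carry_step.
by apply/eq_in_map => u; rewrite mem_iota add0n => /andP[_ hu]; rewrite -act_bit.
Qed.

Lemma res_carry n i s : res n i s = is_look i && carry i s n.
Proof. by case: i. Qed.

End Blocks.

(** * The Turing machine of a program *)

Section Simulation.
Variables (np w' : nat) (c : cmd).
Notation w := w'.+1.

(* [ToEnd] to [Skip] turn the input into blocks: the last input bit is erased
   and its block is emitted, from its last bit to its first, to the left of the
   blocks already built, which a blank separates from the remaining input. *)
Variant mstate :=
  | ToEnd
  | TakeLast
  | ToSep of bool
  | Emit of bool & 'I_w
  | Turn
  | Skip
  | Home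
  | Run of ctl c & 'I_w & bool & bool
  | Return of ctl c & bool
  | Halt of bool.

Definition mstate_code (s : mstate) :
    ('I_5 + bool + bool * 'I_w) + (ctl c * 'I_w * bool * bool + ctl c * bool + bool) :=
  match s with
  | ToEnd => inl (inl (inl (inord 0)))
  | TakeLast => inl (inl (inl (inord 1)))
  | Turn => inl (inl (inl (inord 2)))
  | Skip => inl (inl (inl (inord 3)))
  | Home => inl (inl (inl (inord 4)))
  | ToSep b => inl (inl (inr b))
  | Emit b v => inl (inr (b, v))
  | Run x v m d => inr (inl (inl (x, v, m, d)))
  | Return x b => inr (inl (inr (x, b)))
  | Halt b => inr (inr b)
  end.

Definition mstate_decode
    (s : ('I_5 + bool + bool * 'I_w) +
         (ctl c * 'I_w * bool * bool + ctl c * bool + bool)) : mstate :=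
  match s with
  (* Code 4, that of [Home], is reached as the default of [nth]. *)
  | inl (inl (inl k)) => nth Home [:: ToEnd; TakeLast; Turn; Skip] k
  | inl (inl (inr b)) => ToSep b
  | inl (inr (b, v)) => Emit b v
  | inr (inl (inl (x, v, m, d))) => Run x v m d
  | inr (inl (inr (x, b))) => Return x b
  | inr (inr b) => Halt b
  end.

Lemma mstate_codeK : cancel mstate_code mstate_decode.
Proof. by case=> //=; rewrite inordK. Qed.

HB.instance Definition _ := Finite.copy mstate (can_type mstate_codeK).

(* Track [np] holds the input; a pointer starts without a mark, that is, off the tape. *)
Definition bit0 (b : bool) (v : nat) : bool := (v == np) && b.

Definition mdelta (s : mstate) (a : option bool) : mstate * option bool * bool :=
  match s, a with
  | ToEnd, Some _ => (ToEnd, a, true)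
  | ToEnd, None => (TakeLast, a, false)
  | TakeLast, Some b => (ToSep b, None, false)
  | TakeLast, None => (Home, a, false)
  | ToSep b, Some _ => (ToSep b, a, false)
  | ToSep b, None => (Emit b ord_max, a, false)
  | Emit b v, Some _ => (Emit b v, a, false)
  | Emit b v, None =>
      (if v == ord0 then Turn else Emit b (ord_pred v), Some (bit0 b v), false)
  | Turn, _ => (Skip, a, true)
  | Skip, Some _ => (Skip, a, true)
  | Skip, None => (ToEnd, a, true)
  | Home, Some _ => (Home, a, false)
  | Home, None => (Run (entry c) ord0 (carry0 (code (entry c))) false, a, true)
  | Run x v m d, Some b =>
      let: (m', d', b') := trans (code x) v m d b in
      (Run x (ordS v) m' d', Some b', true)
  | Run x v m d, None => (Return x (is_look (code x) && m), a, false)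
  | Return x b, Some _ => (s, a, false)
  | Return x b, None =>
      (if follow x b is Some y then Run y ord0 (carry0 (code y)) false else Halt b,
       a, true)
  | Halt b, _ => (s, a, true)
  end.

Definition compiled : TM := machine ToEnd (Halt true) (Halt false) mdelta.

Notation step := (@tm_step compiled).
Notation conf := (@config mstate ToEnd (Halt true) (Halt false) mdelta).
Notation confL := (@config_left mstate ToEnd (Halt true) (Halt false) mdelta).

Lemma go_right s l t s' a : s != Halt true -> s != Halt false ->
  mdelta s (head None t) = (s', a, true) ->
  goes step 1 (conf s l t) (conf s' (a :: l) (behead t)).
Proof. by move=> *; exists 1 => //; apply: step_right. Qed.

Lemma go_left s l t s' a : s != Halt true -> s != Halt false ->
  mdelta s (head None t) = (s', a, false) ->
  goes step 1 (conf s l t) (confL s' l (a :: behead t)).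
Proof. by move=> *; exists 1 => //; apply: step_left. Qed.

Definition blank (l : seq (option bool)) : bool := all (pred1 None) l.

Lemma blank_head l : blank l -> head None l = None.
Proof. by case: l => //= a l /andP[/eqP]. Qed.

Lemma blank_behead l : blank l -> blank (behead l).
Proof. by case: l => //= a l /andP[]. Qed.

Lemma run_sweep x v m d bs l t :
  goes step (size bs) (conf (Run x v m d) l (map Some bs ++ t))
    (let: (m', d', bs') := sweep w (code x) v m d bs in
     conf (Run x (inord ((v + size bs) %% w)) m' d') (rev (map Some bs') ++ l) t).
Proof.
elim: bs v m d l => [|b bs IH] v m d l /=.
  by rewrite addn0 modn_small // inord_val; apply: goes_refl.
have := @go_right (Run x v m d) l (map Some (b :: bs) ++ t).
rewrite /=; case: (trans _ _ _ _ _) => [[m1 d1] b1] /= h.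
have h1 := h _ _ isT isT erefl.
rewrite -[_.+1]add1n; apply: (goes_trans h1).
have := IH (ordS v) m1 d1 (Some b1 :: l).
rewrite /= modnDml addSnnS.
by case: (sweep _ _ _ _ _ _) => [[m2 d2] r]; rewrite /= rev_cons cat_rcons.
Qed.

(** Two traversals of the blocks and one step at each turning point give [2 * size bs + 2]. The
    answer is known only at the right end, so [Return] carries it back to the left end, where the
    next instruction starts. *)
Lemma one_sweep x y bs m' d' bs' cf :
  sweep w (code x) 0 (carry0 (code x)) false bs = (m', d', bs') ->
  follow x (is_look (code x) && m') = y -> size bs' = size bs ->
  (exists l t, blank t /\
     cf = conf (Run x ord0 (carry0 (code x)) false) (None :: l) (map Some bs ++ t)) ->
  exists2 cf', goes step (2 * size bs + 2) cf cf' &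
    exists l t, blank t /\
     cf' = if y is Some z
       then conf (Run z ord0 (carry0 (code z)) false) (None :: l) (map Some bs' ++ t)
       else conf (Halt (is_look (code x) && m')) (None :: l) (map Some bs' ++ t).
Proof.
move=> es ey esz [l [t [bt ->]]].
have h1 := @run_sweep x ord0 (carry0 (code x)) false bs (None :: l) t.
rewrite [in X in goes _ _ _ X]/= es in h1.
set b := is_look (code x) && m'.
have h2 : goes step 1 (conf (Run x (inord ((0 + size bs) %% w)) m' d')
    (rev (map Some bs') ++ None :: l) t)
    (confL (Return x b) (rev (map Some bs') ++ None :: l) (None :: behead t)).
  by apply: go_left => //; rewrite (blank_head bt).
have h3 := @scan_left _ ToEnd (Halt true) (Halt false) mdelta (Return x b) (rev bs')
  (None :: l) (None :: behead t) isT isT (fun=> erefl).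
rewrite map_rev revK -map_rev size_rev map_rev in h3.
have := @go_right (Return x b) l (None :: map Some bs' ++ None :: behead t) _ _ isT
  isT erefl.
set z := if _ is Some _ then _ else _; move=> h4.
exists (conf z (None :: l) (map Some bs' ++ None :: behead t)).
  have := goes_trans (goes_trans (goes_trans h1 h2) h3) h4.
  by apply: goes_le; rewrite esz; lia.
exists l, (None :: behead t); split; first exact: blank_behead.
by rewrite /z -ey /b; case: (follow _ _).
Qed.

Hypotheses (np_gt0 : 0 < np) (np_w : np < w) (wf_c : wf_cmd np w c).

Lemma run_simulation n (x : ctl c) s t s' b l r :
  runs n x s t s' b -> blank r ->
  exists2 cf, goes step (t * (2 * (n * w) + 2))
     (conf (Run x ord0 (carry0 (code x)) false) (None :: l) (map Some (blocks np w s
       n) ++ r)) cf &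
    exists l' r', cf = conf (Halt b) l' r'.
Proof.
move=> hr; elim: hr l r => {x s t s' b} [x s hx|x y s t s' b hx _ IH] l r br;
  set cf0 := conf _ _ _.
  have [d hd] := @sweep_blocks np w (code x) s n (ltnW np_w) (wf_code x wf_c).
  have := one_sweep hd; rewrite -res_carry hx => /(_ None cf0 erefl).
  rewrite !size_blocks => /(_ erefl) h.
  have [cf hcf [l' [r' [_ e]]]] := h (ex_intro _ l (ex_intro _ r (conj br erefl))).
  by exists cf; [rewrite mul1n | exists (None :: l'), (map Some (blocks np w (eff
    (code x) s) n) ++ r')].
have [d hd] := @sweep_blocks np w (code x) s n (ltnW np_w) (wf_code x wf_c).
have := one_sweep hd; rewrite -res_carry hx => /(_ (Some y) cf0 erefl).
rewrite !size_blocks => /(_ erefl) h.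
have [cf hcf [l' [r' [br' e]]]] := h (ex_intro _ l (ex_intro _ r (conj br erefl))).
have [cf2 hcf2 [l2 [r2 e2]]] := IH l' r' br'.
exists cf2; last by exists l2, r2.
by rewrite mulSn; apply: goes_trans hcf _; rewrite e.
Qed.

Definition store0 (x : seq bool) : store :=
  Store (fun=> size x) (fun k j => (k == np) && nth false x j).

Definition block0 (b : bool) : seq bool := mkseq (bit0 b) w.

Lemma blocks_store0 x : blocks np w (store0 x) (size x) = flatten (map block0 x).
Proof.
rewrite /blocks; congr flatten.
rewrite -[in RHS](mkseq_nth false x) /mkseq -map_comp; apply/eq_in_map => j.
rewrite mem_iota => /andP[_ hj] /=; apply/eq_in_map => v _.
rewrite /bit /bit0 /=; case: ifP => // hv.
by rewrite ltn_eqF // (ltn_eqF hv).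
Qed.

Lemma emit_block b (v : 'I_w) l t : blank l ->
  exists2 l', blank l' &
  goes step v.+1 (confL (Emit b v) l t)
    (confL Turn l' (map Some (map (bit0 b) (iota 0 v.+1)) ++ t)).
Proof.
have start (u : 'I_w) l0 t0 : blank l0 ->
    confL (Emit b u) l0 t0 = conf (Emit b u) (behead l0) (None :: t0).
  by move=> /blank_head; rewrite /config_left => ->.
case: v => v hv; elim: v hv l t => [|v IH] hv l t bl; rewrite start //.
  exists (behead l); first exact: blank_behead.
  apply: (go_left (s := Emit b (Ordinal hv))) => //=.
have [l' bl' h] := IH (ltnW hv) (behead l) (Some (bit0 b v.+1) :: t) (blank_behead bl).
exists l' => //.
rewrite -[(Ordinal hv).+1]add1n; apply: goes_trans.
  by apply: (go_left (s := Emit b (Ordinal hv))) => //=.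
rewrite (_ : ord_pred _ = Ordinal (ltnW hv)); last first.
  by apply: val_inj => /=; rewrite modnDr modn_small //; exact: ltnW.
have -> : iota 0 (Ordinal hv).+1 = iota 0 v.+1 ++ [:: v.+1].
  by rewrite -addn1 iotaD.
by rewrite !map_cat -catA.
Qed.

(** The separator is given by [head None l = None] rather than by a cons, because on the initial
    tape it is the unwritten cell left of the input. *)
Definition built (rest done : seq bool) (cf : tm_config compiled) : Prop :=
  exists l l' t, [/\ blank l', blank t, head None l = None,
    behead l = rev (map Some (flatten (map block0 done))) ++ l' &
    cf = conf ToEnd l (map Some rest ++ t)].

Lemma size_flatten_block0 y : size (flatten (map block0 y)) = size y * w.
Proof.
elim: y => // b y IH.
by rewrite (_ : flatten _ = block0 b ++ flatten (map block0 y)) // size_cat IH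
  size_mkseq mulSn.
Qed.

(** Consuming the input from its end lets each block be prepended: the blocks come out in input
    order and none has to be moved. *)
Lemma build_step rest b done cf : built (rcons rest b) done cf ->
  exists2 cf', built rest (b :: done) cf' &
  goes step (2 * size rest + 2 * (size done * w) + 2 * w + 8) cf cf'.
Proof.
move=> [L [l [t [bl bt hL bL ->]]]].
set B := flatten (map block0 done).
have h1 := @scan_right _ ToEnd (Halt true) (Halt false) mdelta ToEnd (rcons rest b)
  L t isT isT (fun=> erefl).
rewrite map_rcons rev_rcons cat_rcons /= in h1.
have h2 := @go_left ToEnd (Some b :: rev (map Some rest) ++ L) t _ _
  isT isT (ltac:(by rewrite (blank_head bt))).
have h3 := @go_left TakeLast (rev (map Some rest) ++ L)
   (Some b :: None :: behead t) _ _ isT isT erefl.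
have h4 := @scan_left _ ToEnd (Halt true) (Halt false) mdelta (ToSep b) (rev rest)
   L (None :: None :: behead t) isT isT (fun=> erefl).
rewrite map_rev revK size_rev in h4.
have eL : confL (ToSep b) L = confL (ToSep b) (None :: rev (map Some B) ++ l).
  by rewrite /config_left hL bL.
rewrite eL in h4.
have h5 := @go_left (ToSep b) (rev (map Some B) ++ l)
   (None :: map Some rest ++ None :: None :: behead t) _ _ isT isT erefl.
have h6 := @scan_left _ ToEnd (Halt true) (Halt false) mdelta (Emit b ord_max) (rev B)
   l (None :: map Some rest ++ None :: None :: behead t) isT isT (fun=> erefl).
rewrite map_rev revK size_rev in h6.
have [l' bl' h7] := @emit_block b ord_max l
   (map Some B ++ None :: map Some rest ++ None :: None :: behead t) bl.
set r := None :: map Some rest ++ None :: None :: behead t in h5 h6 h7.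
set B' := map Some (map _ _) in h7.
have h8 := @go_right Turn (behead l') (head None l' :: B' ++ map Some B ++ r) _ _ isT
  isT erefl.
have h9 := @scan_right _ ToEnd (Halt true) (Halt false) mdelta Skip (block0 b ++ B)
   (head None l' :: behead l') r isT isT (fun=> erefl).
rewrite map_cat -catA in h9.
have h10 := @go_right Skip (rev (map Some (block0 b) ++ map Some B) ++ head None l'
  :: behead l') r _ _
   isT isT erefl.
have h := goes_trans (goes_trans (goes_trans (goes_trans (goes_trans (goes_trans
   (goes_trans (goes_trans (goes_trans h1 h2) h3) h4) h5) h6) h7) h8) h9) h10.
rewrite map_rcons cat_rcons; eexists; last first.
  apply: goes_le h; rewrite size_cat size_rcons /B size_flatten_block0 size_mkseq /=;
    lia.
exists (None :: rev (map Some (block0 b ++ B)) ++ head None l' :: behead l').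
exists (head None l' :: behead l'), (None :: None :: behead t); split.
- by rewrite /= blank_head // eqxx -/(blank _) blank_behead.
- by rewrite /= -/(blank _) blank_behead.
- by [].
- by [].
- by rewrite [in RHS]map_cat.
Qed.

(** A step moves one bit from [rest] to [done], so [size rest + size done] is constant and bounds
    the cost of every step. *)
Lemma build_all rest done cf : built rest done cf ->
  exists2 cf', built [::] (rest ++ done) cf' &
  goes step (size rest * (2 * (size rest + size done) * w.+1 + 2 * w + 8)) cf cf'.
Proof.
elim/last_ind: rest done cf => [|rest b IH] done cf hb.
  by exists cf => //; apply: goes_refl.
have [cf1 hb1 h1] := build_step hb.
have [cf2 hb2 h2] := IH _ _ hb1.
exists cf2; first by rewrite cat_rcons.
apply: goes_le (goes_trans h1 h2).
rewrite size_rcons /=; nia.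
Qed.

Lemma initialization x : 0 < size x -> exists l t cf,
  [/\ blank t, cf = conf (Run (entry c) ord0 (carry0 (code (entry c))) false) (None
    :: l)
           (map Some (blocks np w (store0 x) (size x)) ++ t) &
  goes step (size x * (2 * size x * w.+1 + 2 * w + 8) + size x * w + 4)
     (@tm_init compiled x) cf].
Proof.
move=> x_gt0.
have h0 : built x [::] (@tm_init compiled x).
  exists [::], [::], [::]; split=> //.
  by case: x x_gt0 => // a x _; rewrite cats0.
have [cf1 [L [l [t [bl bt hL bL ->]]]] h1] := build_all h0.
rewrite addn0 in h1; rewrite cats0 in bL.
set B := flatten _ in bL.
have toL q l0 t0 : head None l0 = None -> confL q l0 t0 = conf q (behead l0) (None ::
  t0).
  by rewrite /config_left => ->.
have h2 := @go_left ToEnd L t _ _ isT isT (ltac:(by rewrite (blank_head bt))).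
rewrite toL // in h2.
have h3 := @go_left TakeLast (behead L) (None :: None :: behead t) _ _ isT isT erefl.
have h4 := @scan_left _ ToEnd (Halt true) (Halt false) mdelta Home (rev B)
   l (None :: None :: behead t) isT isT (fun=> erefl).
rewrite map_rev revK size_rev (toL Home l) ?blank_head // in h4; rewrite bL in h2 h3.
have h5 := @go_right Home (behead l) (None :: map Some B ++ None :: None :: behead t)
  _ _
   isT isT erefl.
have h := goes_trans (goes_trans (goes_trans (goes_trans h1 h2) h3) h4) h5.
exists (behead l), (None :: None :: behead t), (conf (Run (entry c) ord0 (carry0
  (code (entry c))) false) (None :: behead l)
           (map Some (blocks np w (store0 x) (size x)) ++ (None :: None :: behead
             t))); split.
- by rewrite /= -/(blank _) blank_behead.
- by [].
rewrite blocks_store0; apply: goes_le h.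
by rewrite /B size_flatten_block0; lia.
Qed.

Lemma iter_halt (cf : tm_config compiled) k t : tm_halted cf -> k <= t ->
  forall cf0, iter k step cf0 = cf -> iter t step cf0 = cf.
Proof.
move=> hh hk cf0 e; rewrite -(subnK hk) iterD e.
by elim: (t - k) => //= m ->; rewrite /tm_step hh.
Qed.

Theorem compiled_correct x t s b T :
  0 < size x -> runs (size x) (entry c) (store0 x) t s b ->
  size x * (2 * size x * w.+1 + 2 * w + 8) + size x * w + 4 +
    t * (2 * (size x * w) + 2) <= T ->
  tm_halted (iter T step (@tm_init compiled x)) /\
  (tm_state_after compiled T x == tm_acc compiled) = b.
Proof.
move=> hx hr hT.
have [l [r [cf [br e h1]]]] := initialization hx.
have [cf2 h2 [l' [r' e2]]] := run_simulation l hr br.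
rewrite -e in h2.
have [k hk ek] := goes_trans h1 h2.
have hh : tm_halted cf2 by rewrite e2 halted_config; case: (b).
rewrite /tm_state_after (iter_halt hh (leq_trans hk hT) ek); split=> //.
by rewrite e2 /= (inj_eq enum_rank_inj); case: (b).
Qed.
End Simulation.

(** * Total correctness with time bounds *)

Definition does (n : nat) (c : cmd) (s : store) (T : nat) (Q : store -> Prop) : Prop :=
  exists t s', [/\ ex n c s t s', t <= T & Q s'].

Lemma does_le n c s T1 T2 (Q1 Q2 : store -> Prop) :
  does n c s T1 Q1 -> T1 <= T2 -> (forall s', Q1 s' -> Q2 s') -> does n c s T2 Q2.
Proof.
by move=> [t [s' [e h q]]] hT hQ; exists t, s'; split; [|apply: leq_trans hT|apply: hQ].
Qed.

Lemma does_time n c s T1 T2 (Q : store -> Prop) :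
  T1 <= T2 -> does n c s T1 Q -> does n c s T2 Q.
Proof. by move=> h /does_le; apply. Qed.

Lemma does_do n i s (Q : store -> Prop) : Q (eff i s) -> does n (Do i) s 1 Q.
Proof. by move=> q; exists 1, (eff i s); split=> //; apply: ExDo. Qed.

Lemma does_seq n c1 c2 s T1 T2 (Q1 Q2 : store -> Prop) :
  does n c1 s T1 Q1 -> (forall s1, Q1 s1 -> does n c2 s1 T2 Q2) ->
  does n (Seq c1 c2) s (T1 + T2) Q2.
Proof.
move=> [t1 [s1 [e1 h1 q1]]] /(_ s1 q1) [t2 [s2 [e2 h2 q2]]].
by exists (t1 + t2), s2; split; [apply: ExSeq e1 e2|apply: leq_add|].
Qed.

Lemma does_if n k u c1 c2 s T (Q : store -> Prop) :
  (look n s k u -> does n c1 s T Q) -> (~~ look n s k u -> does n c2 s T Q) ->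
  does n (If k u c1 c2) s T.+1 Q.
Proof.
move=> h1 h2; case: (boolP (look n s k u)) => h.
  by have [t [s' [e ht q]]] := h1 h; exists t.+1, s'; split=> //; apply: ExIfT.
by have [t [s' [e ht q]]] := h2 h; exists t.+1, s'; split=> //; apply: ExIfF.
Qed.

Lemma does_while_end n k u c s T (Q : store -> Prop) :
  ~~ look n s k u -> Q s -> 0 < T -> does n (While k u c) s T Q.
Proof. by move=> h q T0; exists 1, s; split=> //; apply: ExWhileF. Qed.

Lemma does_while_step n k u c s T1 T2 (Q1 Q2 : store -> Prop) :
  look n s k u -> does n c s T1 Q1 ->
  (forall s1, Q1 s1 -> does n (While k u c) s1 T2 Q2) ->
  does n (While k u c) s (T1 + T2).+1 Q2.
Proof.
move=> h [t1 [s1 [e1 h1 q1]]] /(_ s1 q1) [t2 [s2 [e2 h2 q2]]].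
by exists (t1 + t2).+1, s2; split; [apply: ExWhileT e1 e2|rewrite ltnS leq_add|].
Qed.

(** * Frame conditions *)

Definition mod_instr (i : instr) : seq nat :=
  match i with
  | Zero u | Incr u | Copy u _ | Clear u | Put u _ _ | Meet u _ => [:: u]
  | Look _ _ => [::]
  end.

Fixpoint mods (c : cmd) : seq nat :=
  match c with
  | Do i => mod_instr i
  | Seq c1 c2 | If _ _ c1 c2 => mods c1 ++ mods c2
  | While _ _ c1 => mods c1
  end.

Definition keeps (vs : seq nat) (s s' : store) : Prop :=
  {in vs, forall v, ptr s' v = ptr s v /\ trk s' v = trk s v}.

Lemma keeps_refl vs s : keeps vs s s.
Proof. by []. Qed.

Lemma keeps_trans vs s1 s2 s3 : keeps vs s1 s2 -> keeps vs s2 s3 -> keeps vs s1 s3.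
Proof. by move=> h1 h2 v hv; case: (h1 v hv) (h2 v hv) => <- <- [-> ->]. Qed.

Lemma keeps_sub vs vs' s s' : {subset vs' <= vs} -> keeps vs s s' -> keeps vs' s s'.
Proof. by move=> h k v /h /k. Qed.

Lemma keeps_ptr vs s s' v : keeps vs s s' -> v \in vs -> ptr s' v = ptr s v.
Proof. by move=> h /h []. Qed.

Lemma keeps_trk vs s s' k : keeps vs s s' -> k \in vs -> trk s' k = trk s k.
Proof. by move=> h /h []. Qed.

(** The condition is syntactic, so for a concrete command and list it evaluates to [true] and is
    proved by [isT]. *)
Definition frees (vs : seq nat) (c : cmd) : bool := ~~ has (mem vs) (mods c).

Lemma ex_keeps n c s t s' vs : ex n c s t s' -> frees vs c -> keeps vs s s'.
Proof.
rewrite /frees; elim=> {c s t s'} /=.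
- move=> i s hi v hv; have {hi} : v \notin mod_instr i.
    by apply: contra hi => h; apply/hasP; exists v.
  by case: i => //= [u|u|u u'|k|k u c|k l]; rewrite mem_seq1 /upd => /negbTE ->.
- by move=> c1 c2 s s1 s2 t1 t2 _ IH1 _ IH2; rewrite has_cat negb_or => /andP[/IH1 h1
    /IH2]; apply: keeps_trans.
- by move=> k u c1 c2 s s' t _ _ IH; rewrite has_cat negb_or => /andP[/IH].
- by move=> k u c1 c2 s s' t _ _ IH; rewrite has_cat negb_or => /andP[_ /IH].
- by [].
- by move=> k u c s s1 s2 t1 t2 _ _ IH1 _ IH2 h; apply: keeps_trans (IH1 h) (IH2 h).
Qed.

Lemma does_keep vs n c s T (Q : store -> Prop) :
  does n c s T Q -> frees vs c -> does n c s T (fun s' => Q s' /\ keeps vs s s').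
Proof.
by move=> [t [s' [e h q]]] hf; exists t, s'; split=> //; split=> //; apply: ex_keeps
  e hf.
Qed.

Lemma eff_keeps vs i s : frees vs (Do i) -> keeps vs s (eff i s).
Proof. by apply: ex_keeps (ExDo 0 i s). Qed.

(* Numbers below [np] name pointers, those from [np] to [w'] name tracks.
   Pointer 0 stays unused: it is the latch of the instructions that need none,
   and a latch must precede its target.  [pZ] stays at position 0, where the
   flags are kept; [pC] and [pD] stay at the length and the first entry of the
   transition list.  The tracks hold the input [tX], the final states [tF], the
   reachable states [tS], the messages they can send [tM], the transitions not
   yet pruned [tE] and the states connected to a given set [tT]. *)
Notation pZ := 1. Notation p0 := 2. Notation pC := 3. Notation pD := 4.
Notation np := 17.
Notation tX := 17. Notation tF := 18. Notation tS := 19. Notation tM := 20.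
Notation tE := 21. Notation tT := 22. Notation tBad := 27. Notation tA := 28.
Notation tR := 29.
Notation w' := 29.

(* [lC] and [lP] walk over the unary length and the entries of the transition
   list, [lI] counts the entries; [lQ], [lB], [lA], [lR] hold the entry
   (q, is_send, a, q') and [lH] says whether the pass changed anything. *)
Record loop := Loop {
  lC : nat; lP : nat; lI : nat; lQ : nat; lA : nat; lR : nat; lB : nat; lH : nat }.
Definition outer := Loop 5 6 7 8 9 10 23 25.
Definition inner := Loop 11 12 13 14 15 16 24 26.

Definition nop : cmd := Do (Look tX pZ).
Definition read (p v : nat) : cmd :=
  Seq (Do (Zero v)) (Seq (While tX p (Seq (Do (Incr p)) (Do (Incr v)))) (Do (Incr p))).
Definition read_set (c p v k : nat) : cmd :=
  While tX c (Seq (Do (Incr c)) (Seq (read p v) (Do (Put k v true)))).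
Definition fetch (L : loop) : cmd :=
  Seq (Do (Incr (lC L))) (Seq (read (lP L) (lQ L))
  (Seq (Seq (Do (Clear (lB L))) (Seq (If tX (lP L) (Do (Put (lB L) pZ true)) nop)
  (Do (Incr (lP L))))) (Seq (read (lP L) (lA L)) (read (lP L) (lR L))))).
Definition edges (L : loop) (body : cmd) : cmd :=
  Seq (Do (Copy (lC L) pC)) (Seq (Do (Copy (lP L) pD)) (Seq (Do (Zero (lI L)))
  (While tX (lC L) (Seq (fetch L) (Seq body (Do (Incr (lI L)))))))).
Definition fixloop (L : loop) (body : cmd) : cmd :=
  Seq (Do (Put (lH L) pZ true))
      (While (lH L) pZ (Seq (Do (Clear (lH L))) (edges L body))).

(** * Decoding unary numbers from the input *)

Section Streams.
Variable x : seq bool.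
Notation n := (size x).

Definition inp (s : store) : Prop := forall j, trk s tX j = nth false x j.
Definition strm (s : store) (p : nat) (r : seq bool) : Prop := drop (ptr s p) x = r.

Lemma strm_look s p b r : inp s -> strm s p (b :: r) -> look n s tX p = b.
Proof.
move=> hi h; have hp : ptr s p < n.
  rewrite ltnNge; apply/negP => hn.
  by move: h; rewrite /strm drop_oversize.
rewrite /look hp hi /= -[ptr s p]addn0 -nth_drop.
by rewrite (_ : drop _ _ = b :: r).
Qed.

Lemma strm_next s s' p b r :
  strm s p (b :: r) -> ptr s' p = (ptr s p).+1 -> strm s' p r.
Proof.
rewrite /strm => h ->; rewrite -[r](_ : behead (b :: r) = r) // -h.
by rewrite -addn1 addnC -drop_drop drop1.
Qed.

Lemma strm_keeps vs s s' p r : keeps vs s s' -> p \in vs -> strm s p r -> strm s' p r.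
Proof. by move=> k hp; rewrite /strm (keeps_ptr k hp). Qed.

Lemma inp_keeps vs s s' : keeps vs s s' -> tX \in vs -> inp s -> inp s'.
Proof. by move=> k hp hi j; rewrite (keeps_trk k hp). Qed.

Lemma strm_size s p r : strm s p r -> size r <= n.
Proof. by move=> <-; rewrite size_drop leq_subr. Qed.

Lemma does_ones p v s m r : p != v -> p != tX -> v != tX -> inp s ->
  strm s p (nseq m true ++ false :: r) ->
  does n (While tX p (Seq (Do (Incr p)) (Do (Incr v)))) s (3 * m + 1)
    (fun s' => strm s' p (false :: r) /\ ptr s' v = ptr s v + m).
Proof.
move=> hpv hp hv; elim: m s => [|m IH] s hi hs.
  apply: does_while_end; [by rewrite (strm_look hi hs)|by rewrite addn0|by rewrite
    addn1].
apply: (@does_time n _ _ (2 + (3 * m + 1)).+1); first lia.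
apply: does_while_step.
- by rewrite (strm_look hi hs).
- apply: (@does_seq n _ _ s 1 1); first exact: (@does_do _ _ _ (eq _)).
  move=> s1 <-.
  apply: (@does_do _ _ _ (fun s2 => [/\ inp s2, strm s2 p (nseq m true ++ false :: r)
    & ptr s2 v = (ptr s v).+1])).
  split.
  + by move=> j /=; apply: hi.
  + by apply: (strm_next hs) => /=; rewrite /upd (negbTE hpv) eqxx.
  + by rewrite /= /upd eqxx (eq_sym v) (negbTE hpv).
move=> s1 [hi1 hs1 hv1].
by apply: does_le (IH _ hi1 hs1) _ _ => // s' [h1 ->]; rewrite hv1 addSnnS.
Qed.

Lemma does_read p v s m r : p != v -> p != tX -> v != tX -> inp s ->
  strm s p (enc_nat m ++ r) ->
  does n (read p v) s (3 * n + 3) (fun s' => strm s' p r /\ ptr s' v = m).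
Proof.
move=> hpv hp hv hi hs; rewrite /enc_nat cat_rcons in hs.
have hm : m <= n by have := strm_size hs; rewrite size_cat size_nseq; lia.
apply: (@does_time n _ _ (1 + ((3 * m + 1) + 1))); first lia.
apply: does_seq; first exact: (@does_do _ _ _ (eq _)).
move=> s1 <-.
apply: does_seq.
  apply: (@does_ones p v _ m r) => //.
  by rewrite /strm /= /upd (negbTE hpv).
move=> s2 [hs2 /= hv2]; apply: does_do; split.
  by apply: (strm_next hs2); rewrite /= /upd eqxx.
by rewrite /= /upd eq_sym (negbTE hpv) hv2 /upd eqxx.
Qed.

(** [c] stands on the unary length of the list and [p] on its entries: a one under [c] announces
    another entry, so no counter is compared with a bound. *)
Lemma does_read_set c p v k s (l : seq nat) (r r' : seq bool) :
  uniq [:: c; p; v; tX; k] -> inp s ->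
  strm s c (enc_nat (size l) ++ r') -> strm s p (flatten (map enc_nat l) ++ r) ->
  does n (read_set c p v k) s (n * (3 * n + 6) + 1)
    (fun s' => strm s' p r /\ forall j, trk s' k j = trk s k j || (j \in l)).
Proof.
move=> hu hi hc hp.
have hl : size l <= n.
  by have := strm_size hc; rewrite size_cat size_rcons size_nseq; lia.
apply: (@does_time n _ _ (size l * (3 * n + 6) + 1)); first nia.
clear hl; elim: l s hi hc hp => [|m l IH] s hi hc hp.
  apply: does_while_end; [by rewrite (strm_look hi hc)| |by rewrite addn1].
  by split=> // j; rewrite in_nil orbF.
apply: (@does_time n _ _ ((1 + ((3 * n + 3) + 1)) + (size l * (3 * n + 6) + 1)).+1);
  first (rewrite /= mulSn; lia).
apply: (does_while_step (Q1 := fun s1 => [/\ inp s1, strm s1 c (enc_nat (size l) ++ r'),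
   strm s1 p (flatten (map enc_nat l) ++ r) & forall j, trk s1 k j = trk s k j || (j
     == m)])).
- by rewrite (strm_look hi hc).
- move: hu => /= /and5P[]; rewrite !inE !negb_or => /and4P[cp cv cX ck] /and3P[pv pX
    pk] /andP[vX vk] hk _.
  apply: does_seq; first exact: (@does_do _ _ _ (eq _)).
  move=> s1 <-.
  apply: does_seq.
    apply: (does_keep (vs := [:: c; k; tX])).
      apply: (@does_read p v _ m (flatten (map enc_nat l) ++ r)) => //.
      by rewrite /strm /= /upd eq_sym (negbTE cp) catA.
    by rewrite /frees /= !inE; lia.
  move=> s2 [[hp2 hv2] k2]; apply: does_do; split.
  + by move=> j /=; rewrite /upd (negbTE hk) (keeps_trk k2) ?inE ?eqxx ?orbT //;
      apply: hi.
  + by apply: (strm_next hc); rewrite /= (keeps_ptr k2) ?inE ?eqxx //= /upd eqxx.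
  + by [].
  + move=> j; rewrite /= /upd eqxx hv2 (keeps_trk k2) ?inE ?eqxx ?orbT //=.
    by case: (j == m); rewrite ?orbT ?orbF.
move=> s1 [hi1 hc1 hp1 hk1]; apply: does_le (IH _ hi1 hc1 hp1) _ _ => // s' [h1 h2].
by split=> // j; rewrite h2 hk1 inE orbA.
Qed.
End Streams.

Definition t_src (t : nat * bool * nat * nat) : nat := t.1.1.1.
Definition t_send (t : nat * bool * nat * nat) : bool := t.1.1.2.
Definition t_msg (t : nat * bool * nat * nat) : nat := t.1.2.
Definition t_dst (t : nat * bool * nat * nat) : nat := t.2.

(** * Passes over the list of transitions *)

Section Network.
Variable N : instance.
Notation ts := (bdelta N).
Notation m := (size (bdelta N)).
Definition tr_of (k : nat) : nat * bool * nat * nat := nth (0, false, 0, 0) (bdelta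
  N) k.
Notation tr := tr_of.

Notation x := (enc_instance N).
Notation n := (size (enc_instance N)).
Definition fin_code : seq bool := enc_list enc_nat (bfin N).
Definition delta_code (k : nat) : seq bool :=
  flatten (map enc_trans (drop k (bdelta N))) ++ fin_code.

Definition gvars : seq nat := [:: tX; pZ; pC; pD].
Definition glob (s : store) : Prop :=
  [/\ inp x s, ptr s pZ = 0, strm x s pC (enc_nat m ++ delta_code 0) &
      strm x s pD (delta_code 0)].

Lemma glob_keeps s s' : keeps gvars s s' -> glob s -> glob s'.
Proof.
move=> k [h1 h2 h3 h4]; split.
- exact: (inp_keeps k).
- by rewrite (keeps_ptr k).
- exact: (strm_keeps k).
- exact: (strm_keeps k).
Qed.

Lemma size_enc_list_le (T : Type) (e : T -> seq bool) (l : seq T) : size l < size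
  (enc_list e l).
Proof. by rewrite size_cat size_rcons size_nseq ltnS leq_addr. Qed.

(** Unary coding pays off here: states, messages and transition indices are all positions of the
    input, so pointers can hold them and tracks can hold sets of them. *)
Lemma enc_sizes : [/\ nQ N < n, nD N < n & m < n].
Proof.
rewrite !size_cat !size_rcons !size_nseq.
have := size_enc_list_le enc_trans ts.
by split; lia.
Qed.

Lemma n_gt0 : 0 < n.
Proof. by case: enc_sizes => _ _; apply: leq_ltn_trans. Qed.

Lemma look_z s k : glob s -> look n s k pZ = trk s k 0.
Proof. by case=> _ h _ _; rewrite /look h n_gt0. Qed.

Lemma does_fetch L s t l r r' :
  L = outer \/ L = inner -> inp x s -> ptr s pZ = 0 ->
  strm x s (lC L) (enc_nat l.+1 ++ r') -> strm x s (lP L) (enc_trans t ++ r) ->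
  does n (fetch L) s (9 * n + 14)
    (fun s' => [/\ strm x s' (lC L) (enc_nat l ++ r'), strm x s' (lP L) r,
      ptr s' (lQ L) = t_src t & [/\ trk s' (lB L) 0 = t_send t,
      ptr s' (lA L) = t_msg t & ptr s' (lR L) = t_dst t]]).
Proof.
move=> hL hi hz hc hp; case: t hp => [[[q b] a] q']; rewrite /enc_trans -!catA => hp.
pose I0 s' := inp x s' /\ ptr s' pZ = 0.
have keepI s1 s2 : keeps [:: tX; pZ] s1 s2 -> I0 s1 -> I0 s2.
  by move=> k [h1 h2]; split; [apply: (inp_keeps k)|rewrite (keeps_ptr k)].
apply: (@does_time n _ _ (1 + ((3 * n + 3) + ((1 + (2 + 1)) + ((3 * n + 3) + (3 * n +
  3)))))); first lia.
apply: (does_seq (Q1 := fun s1 => [/\ I0 s1, strm x s1 (lC L) (enc_nat l ++ r') &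
   strm x s1 (lP L) (enc_nat q ++ [:: b] ++ enc_nat a ++ enc_nat q' ++ r)])).
  apply: does_do; split.
  - by split=> //; rewrite /= /upd; case: hL => ->.
  - by apply: (strm_next (b := true) hc); rewrite /= /upd eqxx.
  - by move: hp; rewrite /strm /= /upd; case: hL => ->.
move=> s1 [i1 c1 p1].
apply: (does_seq (Q1 := fun s1 => [/\ I0 s1, strm x s1 (lC L) (enc_nat l ++ r'),
   strm x s1 (lP L) ([:: b] ++ enc_nat a ++ enc_nat q' ++ r) & ptr s1 (lQ L) = q])).
  have := does_read _ _ _ i1.1 p1 => /(_ (lQ L)).
  move=> /(_ ltac:(by case: hL => ->) ltac:(by case: hL => ->) ltac:(by case: hL =>
    ->)).
  move=> /(does_keep (vs := [:: tX; pZ; lC L])) /(_ ltac:(by case: hL => ->)).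
  move=> /does_le; apply=> // s2 [[h1 h2] k]; split=> //.
    by apply: keepI i1; apply: keeps_sub k => v; rewrite !inE => /orP[]->; rewrite
      ?orbT.
  by apply: (strm_keeps k) => //; rewrite !inE eqxx ?orbT.
move=> s2 [i2 c2 p2 q2].
apply: (does_seq (Q1 := fun s1 => [/\ I0 s1, strm x s1 (lC L) (enc_nat l ++ r'),
   strm x s1 (lP L) (enc_nat a ++ enc_nat q' ++ r) & ptr s1 (lQ L) = q /\ trk s1 (lB
     L) 0 = b])).
  apply: (does_seq (Q1 := fun s1 => keeps [:: tX; pZ; lC L; lP L; lQ L] s2 s1 /\ trk
    s1 (lB L) 0 = false)).
    apply: does_do; split; last by rewrite /= /upd eqxx.
    by apply: eff_keeps; case: hL => ->.
  move=> s3 [k3 b3].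
  have i3 : I0 s3 by apply: keepI i2; apply: keeps_sub k3 => v; rewrite !inE =>
    /orP[]->; rewrite ?orbT.
  have p3 : strm x s3 (lP L) ([:: b] ++ enc_nat a ++ enc_nat q' ++ r).
    by apply: (strm_keeps k3) => //; rewrite !inE eqxx ?orbT.
  apply: (does_seq (Q1 := fun s1 => keeps [:: tX; pZ; lC L; lP L; lQ L] s2 s1 /\ trk
    s1 (lB L) 0 = b)).
    apply: does_if; rewrite (strm_look i3.1 p3) => hb; apply: does_do.
      split; last by rewrite /= /upd eqxx i3.2 eqxx hb.
      by apply: keeps_trans k3 _; apply: eff_keeps; case: hL => ->.
    by split=> //; rewrite b3 (negbTE hb).
  move=> s4 [k4 b4]; apply: does_do.
  set s5 := eff _ _.
  have k5 : keeps [:: tX; pZ; lC L; lQ L] s2 s5.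
    apply: (keeps_trans (s2 := s4)); last by apply: eff_keeps; case: hL => ->.
    by apply: keeps_sub k4 => v; rewrite !inE => /or4P[]->; rewrite ?orbT.
  split=> //.
  - by apply: keepI i2; apply: keeps_sub k5 => v; rewrite !inE => /orP[]->; rewrite
      ?orbT.
  - by apply: (strm_keeps k5) => //; rewrite !inE eqxx ?orbT.
  - apply: (strm_next p2); rewrite /= /upd eqxx (keeps_ptr k4) //.
    by rewrite !inE eqxx ?orbT.
  - by split=> //; rewrite (keeps_ptr k5) // !inE eqxx ?orbT.
move=> s3 [i3 c3 p3 [q3 b3]].
apply: (does_seq (Q1 := fun s1 => [/\ I0 s1, strm x s1 (lC L) (enc_nat l ++ r'),
   strm x s1 (lP L) (enc_nat q' ++ r) & [/\ ptr s1 (lQ L) = q, trk s1 (lB L) 0 = b &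
     ptr s1 (lA L) = a]])).
  have := does_read _ _ _ i3.1 p3 => /(_ (lA L)).
  move=> /(_ ltac:(by case: hL => ->) ltac:(by case: hL => ->) ltac:(by case: hL =>
    ->)).
  move=> /(does_keep (vs := [:: tX; pZ; lC L; lQ L; lB L])) /(_ ltac:(by case: hL =>
    ->)).
  move=> /does_le; apply=> // s4 [[h1 h2] k]; split=> //.
  - by apply: keepI i3; apply: keeps_sub k => v; rewrite !inE => /orP[]->; rewrite
      ?orbT.
  - by apply: (strm_keeps k) => //; rewrite !inE eqxx ?orbT.
  - by split=> //; rewrite ?(keeps_ptr k) ?(keeps_trk k) // !inE eqxx ?orbT.
move=> s4 [i4 c4 p4 [q4 b4 a4]].
have := does_read _ _ _ i4.1 p4 => /(_ (lR L)).
move=> /(_ ltac:(by case: hL => ->) ltac:(by case: hL => ->) ltac:(by case: hL => ->)).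
move=> /(does_keep (vs := [:: lC L; lQ L; lB L; lA L])) /(_ ltac:(by case: hL => ->)).
move=> /does_le; apply=> // s5 [[h1 h2] k]; split=> //.
- by apply: (strm_keeps k) => //; rewrite !inE eqxx ?orbT.
- by rewrite ?(keeps_ptr k) // !inE eqxx ?orbT.
- by split=> //; rewrite ?(keeps_ptr k) ?(keeps_trk k) // !inE eqxx ?orbT.
Qed.

Definition cur (L : loop) (k : nat) (s : store) : Prop :=
  [/\ ptr s (lI L) = k, ptr s (lQ L) = t_src (tr k), trk s (lB L) 0 = t_send (tr k),
      ptr s (lA L) = t_msg (tr k) & ptr s (lR L) = t_dst (tr k)].

Definition lvars (L : loop) : seq nat :=
  [:: lC L; lP L; lI L; lQ L; lA L; lR L; lB L].

Definition apart (vs us : seq nat) : bool := ~~ has (mem us) vs.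

Definition edges_time (T : nat) : nat := n * (9 * n + T + 16) + 4.

(** The loop rule of a pass. [deps] lists the names on which the invariant depends, so the
    bookkeeping of the pass preserves it. The body may overwrite the fetched fields, which the next
    [fetch] renews. The final position of [lP L] is recorded because it locates the list of final
    states. *)
Lemma does_edges L body deps (Inv : nat -> store -> Prop) T s :
  L = outer \/ L = inner ->
  (forall k s s', keeps deps s s' -> Inv k s -> Inv k s') ->
  apart (lvars L) deps ->
  frees (gvars ++ [:: lC L; lP L; lI L]) body ->
  (forall k s, k < m -> glob s -> Inv k s -> cur L k s -> does n body s T (Inv k.+1)) ->
  glob s -> Inv 0 s ->
  does n (edges L body) s (edges_time T)
    (fun s' => [/\ glob s', Inv m s' & strm x s' (lP L) fin_code]).
Proof.
move=> hL stab hdeps hbody hstep hg hI.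
have frees_l i : all (mem (lvars L)) (mod_instr i) -> frees deps (Do i).
  move=> /allP h; apply/hasPn => v /= /h; move: v.
  by apply/hasPn.
have frees_g i : all (mem (lvars L)) (mod_instr i) -> frees gvars (Do i).
  move=> /allP h; apply/hasPn => v /= /h; move: v {h}; apply/hasPn.
  by case: hL => ->.
pose st k s' := [/\ glob s', Inv k s', strm x s' (lC L) (enc_nat (m - k) ++
  delta_code 0),
  strm x s' (lP L) (delta_code k) & ptr s' (lI L) = k].
have hm : m <= n by have [_ _ /ltnW] := enc_sizes.
apply: (@does_time n _ _ (1 + (1 + (1 + (m * (9 * n + T + 16) + 1))))).
  by rewrite /edges_time; nia.
apply: (does_seq (Q1 := fun s1 => [/\ glob s1, Inv 0 s1 & strm x s1 (lC L) (enc_nat m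
  ++ delta_code 0)])).
  apply: does_do; split.
  - by apply: glob_keeps hg; apply: eff_keeps; apply: frees_g; rewrite /= !inE eqxx.
  - by apply: stab hI; apply: eff_keeps; apply: frees_l; rewrite /= !inE eqxx.
  - by case: hg => _ _ h _; rewrite /strm /= /upd eqxx.
move=> s1 [g1 I1 c1].
apply: (does_seq (Q1 := fun s1 => [/\ glob s1, Inv 0 s1, strm x s1 (lC L) (enc_nat m
  ++ delta_code 0) & strm x s1 (lP L) (delta_code 0)])).
  apply: does_do; split.
  - by apply: glob_keeps g1; apply: eff_keeps; apply: frees_g; rewrite /= !inE eqxx
      orbT.
  - by apply: stab I1; apply: eff_keeps; apply: frees_l; rewrite /= !inE eqxx orbT.
  - by move: c1; rewrite /strm /= /upd; case: hL => ->.
  - by case: g1 => _ _ _ h; rewrite /strm /= /upd eqxx.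
move=> s2 [g2 I2 c2 p2].
apply: (does_seq (Q1 := st 0)).
  apply: does_do; split.
  - by apply: glob_keeps g2; apply: eff_keeps; apply: frees_g; rewrite /= !inE eqxx
      ?orbT.
  - by apply: stab I2; apply: eff_keeps; apply: frees_l; rewrite /= !inE eqxx ?orbT.
  - by move: c2; rewrite subn0 /strm /= /upd; case: hL => ->.
  - by move: p2; rewrite /strm /= /upd; case: hL => ->.
  - by rewrite /= /upd eqxx.
suff gen l k s3 : m - k = l -> k <= m -> st k s3 ->
    does n (While tX (lC L) (Seq (fetch L) (Seq body (Do (Incr (lI L)))))) s3
      (l * (9 * n + T + 16) + 1)
      (fun s' => [/\ glob s', Inv m s' & strm x s' (lP L) fin_code]).
  by move=> s3 /gen; apply=> //; rewrite subn0.
elim: l k s3 => [|l IH] k s3 ek hk [g3 I3 c3 p3 i3].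
  have {hk}ek : k = m by lia.
  rewrite ek subnn in c3; rewrite ek /delta_code drop_size in p3; rewrite ek in I3.
  apply: does_while_end.
  - by case: g3 => hi _ _ _; rewrite (strm_look hi c3).
  - by split.
  - by rewrite addnC.
apply: (@does_time n _ _ (((9 * n + 14) + (T + 1)) + (l * (9 * n + T + 16) + 1)).+1);
  first (rewrite mulSn; lia).
have hkm : k < m by lia.
rewrite ek in c3.
have ed : delta_code k = enc_trans (tr k) ++ delta_code k.+1.
  by rewrite /delta_code (drop_nth (0, false, 0, 0) hkm) /= catA.
rewrite ed in p3.
have [hi hz _ _] := g3.
apply: (does_while_step (Q1 := st k.+1)).
- by rewrite (strm_look hi c3).
- apply: (does_seq (Q1 := fun s1 => [/\ glob s1, Inv k s1, strm x s1 (lC L) (enc_nat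
    l ++ delta_code 0),
     strm x s1 (lP L) (delta_code k.+1) & cur L k s1])).
    have := does_fetch hL hi hz c3 p3.
    move=> /(does_keep (vs := deps ++ lI L :: gvars)).
    have hf : frees (deps ++ lI L :: gvars) (fetch L).
      move: hdeps {hstep stab hbody frees_l frees_g st I3 i3 g3 c3 p3 hi hz IH};
        rewrite /apart /frees => h.
      apply/hasPn => v hv; rewrite inE mem_cat negb_or; apply/andP; split.
        by move: v hv; apply/hasPn; apply: contra h; case: hL => -> /=; lia.
      by move: v hv; apply/hasPn; case: hL => ->.
    move=> /(_ hf) /does_le; apply=> // s4 [[c4 p4 q4 [b4 a4 r4]] k4]; split=> //.
    + by apply: glob_keeps g3; apply: keeps_sub k4 => v hv; rewrite mem_cat inE hv
        !orbT.
    + by apply: stab I3; apply: keeps_sub k4 => v hv; rewrite mem_cat inE hv.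
    + by split=> //; rewrite (keeps_ptr k4) // mem_cat inE eqxx orbT.
  move=> s4 [g4 I4 c4 p4 cu4].
  have := hstep k s4 hkm g4 I4 cu4 => /(does_keep (vs := gvars ++ [:: lC L; lP L; lI
    L])) /(_ hbody) h.
  apply: does_seq h _ => s5 [I5 k5]; apply: does_do; split.
  + apply: (glob_keeps (s := s5)).
      by apply: eff_keeps; apply: frees_g; rewrite /= !inE eqxx ?orbT.
    by apply: glob_keeps g4; apply: keeps_sub k5 => v hv; rewrite mem_cat hv.
  + by apply: stab I5; apply: eff_keeps; apply: frees_l; rewrite /= !inE eqxx ?orbT.
  + have c5 := strm_keeps (p := lC L) k5 (ltac:(by rewrite mem_cat !inE eqxx ?orbT)) c4.
    have -> : m - k.+1 = l by lia.
    by move: c5; rewrite /strm /= /upd; case: hL => ->.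
  + have p5 := strm_keeps (p := lP L) k5 (ltac:(by rewrite mem_cat !inE eqxx ?orbT)) p4.
    by move: p5; rewrite /strm /= /upd; case: hL => ->.
  + rewrite /= /upd eqxx (keeps_ptr k5); first by case: cu4 => ->.
    by rewrite mem_cat !inE eqxx ?orbT.
move=> s4 h4; apply: does_le (IH k.+1 s4 _ _ h4) _ _ => //; lia.
Qed.
End Network.

Lemma does_do_seq n i c s T Q : does n c (eff i s) T Q -> does n (Seq (Do i) c) s
  T.+1 Q.
Proof.
by move=> h; apply: (@does_seq n _ _ s 1 T (eq (eff i s))); [apply: does_do|move=> _
  <-].
Qed.

Lemma does_conj n c s T (Q1 Q2 : store -> Prop) :
  does n c s T Q1 -> (forall s', Q1 s' -> Q2 s') -> does n c s T Q2.
Proof. by move=> h; apply: does_le h (leqnn _). Qed.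

Lemma does_nop n s T (Q : store -> Prop) : 0 < T -> Q s -> does n nop s T Q.
Proof. by move=> h q; apply: (does_time h); apply: does_do. Qed.

Lemma count_iota_lt (p q : pred nat) K v :
  subpred p q -> q v -> ~~ p v -> v < K -> count p (iota 0 K) < count q (iota 0 K).
Proof.
move=> sub qv pv hv; rewrite -addn1.
have <- : count (pred1 v) (iota 0 K) = 1.
  by rewrite count_uniq_mem ?iota_uniq // mem_iota hv.
rewrite -count_predUI [X in _ + X](_ : _ = 0) ?addn0.
  by apply: sub_count => u /= /orP[/sub|/eqP->].
apply/eqP; rewrite eqn0Ngt -has_count; apply/hasPn => u _ /=.
by case: eqP => [->|]; rewrite ?andbF ?andbT.
Qed.

Lemma count_iota_le (p : pred nat) K : count p (iota 0 K) <= K.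
Proof. by rewrite -[X in _ <= X](size_iota 0) count_size. Qed.

Lemma keeps_eff vs i s s' : keeps vs s s' -> frees vs (Do i) -> keeps vs s (eff i s').
Proof. by move=> k /(eff_keeps s'); apply: keeps_trans. Qed.

(** * Fixpoint loops and the pruning of transitions *)

Section Program.
Variable N : instance.
Notation x := (enc_instance N).
Notation n := (size (enc_instance N)).
Notation m := (size (bdelta N)).
Notation tr := (tr_of N).
Notation glob := (glob N).
Notation cur := (cur N).

Lemma look_at s k u v : ptr s u = v -> v < n -> look n s k u = trk s k v.
Proof. by rewrite /look => -> ->. Qed.

Definition fix_time (T B : nat) : nat := 1 + (B.+1 * (edges_time N T + 3) + 1).

(** A change can destroy [Cl] for transitions visited earlier in the same pass, so [Cl] is concluded
    only from a pass that leaves [deps] untouched. Every other pass lowers [mu], whence at most [B]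
    changing passes and a quiet one. *)
Lemma does_fix L body deps (J : store -> Prop) (Cl : nat -> store -> Prop) (mu :
  store -> nat) B T s :
  L = outer \/ L = inner ->
  (forall s s', keeps deps s s' -> J s -> J s') ->
  (forall k s s', keeps deps s s' -> Cl k s -> Cl k s') ->
  (forall s s', keeps deps s s' -> mu s' = mu s) ->
  apart (lvars L ++ [:: lH L]) deps ->
  frees (gvars ++ [:: lC L; lP L; lI L]) body ->
  (forall k s, k < m -> glob s -> J s -> cur L k s ->
     does n body s T (fun s' =>
       (keeps deps s s' /\ Cl k s' /\ trk s' (lH L) 0 = trk s (lH L) 0) \/
       [/\ J s', mu s' < mu s & trk s' (lH L) 0])) ->
  glob s -> J s -> mu s <= B ->
  does n (fixloop L body) s (fix_time T B)
    (fun s' => [/\ glob s', J s' & forall k, k < m -> Cl k s']).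
Proof.
move=> hL sJ sC sM hdeps hbody hstep hg hJ hB.
have dH i : mod_instr i = [:: lH L] -> frees (gvars ++ deps) (Do i).
  move=> e; rewrite /frees [mods _]e has_seq1; change (lH L \notin gvars ++ deps).
  rewrite mem_cat negb_or; apply/andP; split; first by case: hL => ->.
  by move: hdeps; rewrite /apart has_cat negb_or has_seq1 => /andP[].
have kg s1 s2 : keeps (gvars ++ deps) s1 s2 -> keeps gvars s1 s2.
  by apply: keeps_sub => v hv; rewrite mem_cat hv.
have kd s1 s2 : keeps (gvars ++ deps) s1 s2 -> keeps deps s1 s2.
  by apply: keeps_sub => v hv; rewrite mem_cat hv orbT.
have pass s1 : glob s1 -> J s1 ->
    does n (Seq (Do (Clear (lH L))) (edges L body)) s1 (edges_time N T).+1
    (fun s' => [/\ glob s', J s' &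
       (trk s' (lH L) 0 = false /\ forall k, k < m -> Cl k s') \/
       (mu s' < mu s1 /\ trk s' (lH L) 0)]).
  move=> g1 J1; apply: does_do_seq; set s2 := eff _ _.
  have k2 : keeps (gvars ++ deps) s1 s2 by apply/eff_keeps/dH.
  (* Inside a pass either nothing has changed yet and the visited transitions satisfy [Cl], or the
     flag is up and [mu] has dropped. *)
  pose Inv k s' := J s' /\
    ((keeps deps s2 s' /\ trk s' (lH L) 0 = false /\ forall j, j < k -> Cl j s') \/
     (mu s' < mu s2 /\ trk s' (lH L) 0)).
  have stab k s3 s4 : keeps (lH L :: deps) s3 s4 -> Inv k s3 -> Inv k s4.
    move=> k4; have k4d : keeps deps s3 s4 by apply: keeps_sub k4 => v; rewrite inE
      orbC => ->.
    have e4 : trk s4 (lH L) = trk s3 (lH L) by rewrite (keeps_trk k4) // inE eqxx.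
    rewrite /Inv e4 (sM _ _ k4d) => -[J3 h3]; split; first exact: sJ J3.
    case: h3 => [[k3 [H3 C3]]|h3]; [left|by right]; split; first exact: keeps_trans k4d.
    by split=> // j /C3; apply: sC.
  have hd : apart (lvars L) (lH L :: deps).
    apply/hasPn => v hv; rewrite inE negb_or; apply/andP; split.
      by move: v hv; apply/hasPn; case: hL => ->.
    by apply: (hasPn hdeps); rewrite mem_cat hv.
  apply: does_conj (does_edges hL stab hd hbody _ (glob_keeps (kg _ _ k2) g1) _) _.
  - move=> k s3 hk g3 [J3 h3] c3; apply: does_conj (hstep _ _ hk g3 J3 c3) _ => s4.
    case=> [[k4 [C4 H4]]|[J4 M4 H4]]; split=> //; first exact: sJ J3.
    + case: h3 => [[k3 [H3 C3]]|[M3 H3]]; [left|right]; last by rewrite (sM _ _ k4) H4.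
      split; first exact: keeps_trans k4.
      split; first by rewrite H4.
      by move=> j; rewrite ltnS leq_eqVlt => /orP[/eqP->//|/C3]; apply: sC.
    + right; split=> //.
      by case: h3 => [[k3 _]|[M3 _]]; [rewrite -(sM _ _ k3)|apply: ltn_trans M3].
  - split; first exact: sJ (kd _ _ k2) J1.
    by left; split; [exact: keeps_refl|split=> //; rewrite /s2 /= /upd eqxx].
  move=> s3 [g3 [J3 h3] _]; split=> //.
  by case: h3 => [[_ h3]|h3]; [left|right; rewrite -(sM _ _ (kd _ _ k2))].
rewrite /fix_time add1n; apply: does_do_seq; set s1 := eff _ _.
have k1 : keeps (gvars ++ deps) s s1 by apply/eff_keeps/dH.
have {}hg : glob s1 by apply: glob_keeps (kg _ _ k1) hg.
have {}hJ : J s1 by apply: sJ (kd _ _ k1) hJ.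
have {}hB : mu s1 <= B by rewrite (sM s _ (kd _ _ k1)).
(* Generalized for the induction: when the flag is found down on testing, [Cl] is already known for
   all transitions. *)
have : trk s1 (lH L) 0 \/ (forall k, k < m -> Cl k s1).
  by left; rewrite /s1 /= /upd eqxx; case: hg => _ -> _ _.
elim: B s1 hg hJ hB {k1} => [|B IH] s1 hg hJ hB hor.
all: have [hH|hH] := boolP (trk s1 (lH L) 0); last first.
1,3: by apply: does_while_end; rewrite ?(look_z _ hg) //; last (by rewrite addnC);
     split=> //; case: hor hH => // ->.
  apply: (@does_time _ _ _ ((edges_time N T).+1 + 1).+1); first lia.
  apply: does_while_step (pass _ hg hJ) _; first by rewrite look_z.
  move=> s2 [g2 J2 h2]; case: h2 => [[H2 C2]|[h2 _]]; last by exfalso; lia.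
  by apply: does_while_end; rewrite ?(look_z _ g2) ?H2.
apply: (@does_time _ _ _ ((edges_time N T).+1 + (B.+1 * (edges_time N T + 3) +
  1)).+1); first lia.
apply: does_while_step (pass _ hg hJ) _; first by rewrite look_z.
move=> s2 [g2 J2 h2]; case: h2 => [[H2 C2]|[h2 H2]].
  by apply: does_while_end; rewrite ?(look_z _ g2) ?H2 // addnC.
by apply: IH => //; [lia|left].
Qed.


Hypothesis wfN : wf_instance N.

Lemma tr_bounds k : k < m ->
  [/\ t_src (tr k) < nQ N, t_msg (tr k) < nD N & t_dst (tr k) < nQ N].
Proof.
move=> hk; case/and3P: wfN => _ _ /allP /(_ (tr k)); rewrite mem_nth // => /(_ isT).
by case: (tr k) => [[[q b] a] q'] /and3P[].
Qed.

Definition edge (E : nat -> bool) (u v : nat) : Prop :=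
  exists k, [/\ k < m, E k, t_src (tr k) = u & t_dst (tr k) = v].

Inductive conn (E : nat -> bool) (u : nat) : nat -> Prop :=
  | conn_refl : conn E u u
  | conn_step v w : conn E u v -> edge E v w -> conn E u w.

Definition receivable (E : nat -> bool) (k : nat) : Prop :=
  exists j, [/\ j < m, E j, t_send (tr j) & t_msg (tr j) = t_msg (tr k)].

Definition good_edge (E : nat -> bool) (k : nat) : Prop :=
  (~~ t_send (tr k) -> receivable E k) /\
  (exists f, [/\ f \in bfin N, conn E (t_dst (tr k)) f & conn E f (t_src (tr k))]).

Inductive reach : nat -> Prop :=
  | reach_init q : q \in binit N -> reach q
  | reach_send q a q' : reach q -> (q, true, a, q') \in bdelta N -> reach q'
  | reach_recv p a p' q q' : reach p -> (p, true, a, p') \in bdelta N ->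
      reach q -> (q, false, a, q') \in bdelta N -> reach q'.

Let ltn_q v : v < nQ N -> v < n.
Proof. by have [h _ _] := enc_sizes N => /ltn_trans; apply. Qed.
Let ltn_d v : v < nD N -> v < n.
Proof. by have [_ h _] := enc_sizes N => /ltn_trans; apply. Qed.
Let ltn_m v : v < m -> v < n.
Proof. by have [_ _ h] := enc_sizes N => /ltn_trans; apply. Qed.

Definition raise (L : loop) : cmd := Do (Put (lH L) pZ true).

Definition saturate_body : cmd :=
  If tE (lI inner) (If tT (lQ inner) (If tT (lR inner) nop
    (Seq (Do (Put tT (lR inner) true)) (raise inner))) nop) nop.
Definition saturate : cmd := fixloop inner saturate_body.

Lemma does_saturate s : glob s ->
  does n saturate s (fix_time 5 n) (fun s' => glob s' /\
    forall v, trk s' tT v <-> exists2 u, trk s tT u & conn (trk s tE) u v).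
Proof.
move=> hg.
pose J s' := [/\ forall v, trk s tT v -> trk s' tT v,
   forall v, trk s' tT v -> exists2 u, trk s tT u & conn (trk s tE) u v & trk s' tE =
     trk s tE].
pose Cl k s' := trk s' tE k -> trk s' tT (t_src (tr k)) -> trk s' tT (t_dst (tr k)).
pose mu s' := count (fun v => ~~ trk s' tT v) (iota 0 (nQ N)).
have ft := fun s1 s2 (k : keeps [:: tE; tT] s1 s2) => keeps_trk (k := tT) k isT.
have fe := fun s1 s2 (k : keeps [:: tE; tT] s1 s2) => keeps_trk (k := tE) k isT.
apply: does_conj (@does_fix inner saturate_body [:: tE; tT] J Cl mu n 5 s (or_intror
  erefl) _ _ _ isT isT _ hg _ _) _.
- by move=> s1 s2 k; rewrite /J (ft _ _ k) (fe _ _ k).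
- by move=> j s1 s2 k; rewrite /Cl (ft _ _ k) (fe _ _ k).
- by move=> s1 s2 k; rewrite /mu (ft _ _ k).
- move=> k s1 hk g1 [J1 J2 J3] [ci cq _ _ cr].
  have [bq _ br] := tr_bounds hk.
  apply: does_if; rewrite (look_at _ ci (ltn_m hk)) => hE; last first.
    apply: does_nop => //; left; split; first exact: keeps_refl.
    by split=> // hE'; rewrite hE' in hE.
  apply: does_if; rewrite (look_at _ cq (ltn_q bq)) => hQ; last first.
    apply: does_nop => //; left; split; first exact: keeps_refl.
    by split=> // _ hQ'; rewrite hQ' in hQ.
  apply: does_if; rewrite (look_at _ cr (ltn_q br)) => hR.
    by apply: does_nop => //; left; split; [exact: keeps_refl|split=> // _ _].
  apply: does_do_seq; apply: does_do; right.
  split; rewrite ?/J ?/mu /= ?/upd /=.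
  + rewrite cr; split=> // v; first by case: eqP => // _ /J1.
    case: eqP => [-> _|_]; last exact: J2.
    have [u hu huv] := J2 _ hQ; exists u => //; apply: conn_step huv _.
    by exists k; rewrite -J3.
  + apply: (@count_iota_lt _ _ _ (t_dst (tr k))) => //=; rewrite cr ?eqxx //.
    by move=> v; case: eqP.
  + by case: g1 => _ -> _ _; rewrite eqxx.
- by split=> // v hv; exists v => //; apply: conn_refl.
- by apply: leq_trans (count_iota_le _ _) _; have [/ltnW] := enc_sizes N.
move=> s' [g' [J1 J2 J3] hC]; split=> // v; split; first exact: J2.
case=> u hu; elim=> {v} [|v w _ IH [k [hk hE es <-]]]; first exact: J1.
by apply: hC => //; rewrite ?J3 ?es.
Qed.

Definition recv_body : cmd :=
  If tE (lI inner) (If (lB inner) pZ (If tA (lA inner)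
    (Do (Put tR pZ true)) nop) nop) nop.
(** No instruction compares two pointers. The message of the outer transition is stored as the
    singleton [tA], and equality with it becomes membership in [tA]. *)
Definition recv_check : cmd :=
  Seq (Do (Clear tA)) (Seq (Do (Put tA (lA outer) true)) (Seq (Do (Clear tR))
    (edges inner recv_body))).

Lemma does_recv_check s k : glob s -> k < m -> cur outer k s ->
  does n recv_check s (edges_time N 4 + 3) (fun s' => glob s' /\
    (trk s' tR 0 <-> receivable (trk s tE) k)).
Proof.
move=> hg hk hcur; rewrite addnC !addSn add0n.
do 3!apply: does_do_seq; set s1 := eff _ _.
have k1 : keeps (tE :: gvars) s s1.
  by do 3!apply: keeps_eff => //.
have g1 : glob s1 by apply: glob_keeps hg; apply: keeps_sub k1 => v hv; rewrite
  in_cons hv orbT.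
have a1 v : trk s1 tA v = (v == t_msg (tr k)).
  by rewrite /s1 /= /upd /=; case: hcur => _ _ _ -> _; case: eqP.
pose Inv j s' := [/\ trk s' tE = trk s tE, trk s' tA = trk s1 tA &
  trk s' tR 0 <-> exists i, [/\ i < j, trk s tE i, t_send (tr i) & t_msg (tr i) =
    t_msg (tr k)]].
apply: does_conj (@does_edges N inner recv_body [:: tE; tA; tR] Inv 4 s1 (or_intror
  erefl) _ isT isT _ g1 _) _.
- move=> j s2 s3 kk; rewrite /Inv (keeps_trk (k := tE) kk isT).
  by rewrite (keeps_trk (k := tA) kk isT) (keeps_trk (k := tR) kk isT).
- move=> j s2 hj g2 [J1 J2 J3] [ci cq cb ca cr].
  have [_ ba _] := tr_bounds hj.
  have skip s3 : trk s3 tE = trk s2 tE -> trk s3 tA = trk s2 tA -> trk s3 tR = trk s2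
    tR ->
      ~ [/\ trk s tE j, t_send (tr j) & t_msg (tr j) = t_msg (tr k)] -> Inv j.+1 s3.
    move=> e1 e2 e3 hne; rewrite /Inv e1 e2 e3; split=> //; rewrite J3.
    split=> [[i [h1 h2 h3 h4]]|[i [h1 h2 h3 h4]]]; exists i; split=> //; first exact:
      leqW.
    move: h1; rewrite ltnS leq_eqVlt => /orP[/eqP ei|//].
    by case: hne; rewrite -ei.
  apply: does_if; rewrite (look_at _ ci (ltn_m hj)) J1 => hE; last first.
    by apply: does_nop => //; apply: skip => // -[hE']; rewrite hE' in hE.
  apply: does_if; rewrite (look_z _ g2) cb => hB; last first.
    by apply: does_nop => //; apply: skip => // -[_ hE']; rewrite hE' in hB.
  apply: does_if; rewrite (look_at _ ca (ltn_d ba)) J2 a1 => hM; last first.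
    by apply: does_nop => //; apply: skip => // -[_ _ hE']; rewrite hE' eqxx in hM.
  apply: does_do; split=> //=; case: g2 => _ -> _ _; rewrite /upd /=.
  by split=> // _; exists j; split=> //; apply/eqP.
- split=> //.
  by split=> [|[i []]] //.
by move=> s' [g' [_ _ hR] _]; split.
Qed.

Definition flag_bad : cmd := Do (Put tBad pZ true).

(** A walk from the target back to the source through a final state is found by two closures: that
    of the target is cut down to its final states, and the source must lie in the closure of what
    remains. *)
Definition check : cmd :=
  Seq (Do (Clear tBad)) (Seq (If (lB outer) pZ nop (Seq recv_check (If tR pZ nop
    flag_bad)))
  (Seq (Do (Clear tT)) (Seq (Do (Put tT (lR outer) true)) (Seq saturate
  (Seq (Do (Meet tT tF)) (Seq saturate (If tT (lQ outer) nop flag_bad))))))).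

Definition check_time : nat := (edges_time N 4 + 6) + 2 * fix_time 5 n + 6.

Lemma does_check s k : glob s -> k < m -> cur outer k s ->
  (forall v, trk s tF v = (v \in bfin N)) ->
  does n check s check_time (fun s' => glob s' /\
    (trk s' tBad 0 = false <-> good_edge (trk s tE) k)).
Proof.
move=> hg hk hcur hF.
have [bq _ br] := tr_bounds hk.
apply: (@does_time _ _ _ ((edges_time N 4 + 3 + 2).+1 + (fix_time 5 n + (fix_time 5 n
  + 2).+1).+2).+1).
  by rewrite /check_time; lia.
pose V := [:: tE; tF; lQ outer; lR outer; lI outer; lB outer; lA outer] ++ gvars.
have VG s1 s2 : keeps V s1 s2 -> glob s1 -> glob s2.
  by move=> h; apply: glob_keeps; apply: keeps_sub h => v hv; rewrite mem_cat hv orbT.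
apply: does_do_seq; set s1 := eff _ _.
have k1 : keeps V s s1 by exact: eff_keeps.
have g1 := VG _ _ k1 hg.
apply: (does_seq (Q1 := fun s2 => keeps V s s2 /\
   (trk s2 tBad 0 = false <-> (~~ t_send (tr k) -> receivable (trk s tE) k)))).
  apply: does_if; rewrite (look_z _ g1) (_ : trk s1 (lB outer) 0 = t_send (tr k));
    last 1 first.
  - by case: hcur.
  - move=> hS; apply: does_nop; first by rewrite addnC.
    by split=> //; rewrite hS.
  - by case: hcur.
  move=> hS.
  have c1 : cur outer k s1 by case: hcur => *; split.
  apply: does_seq (does_keep (vs := tBad :: V) (does_recv_check g1 hk c1) isT) _.
  move=> s2 [[g2 r2] k2].
  have k2V : keeps V s s2.
    by apply: keeps_trans k1 _; apply: keeps_sub k2 => v hv; rewrite in_cons hv orbT.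
  have b2 : trk s2 tBad 0 = false by rewrite (keeps_trk k2).
  apply: does_if; rewrite (look_z _ g2) => hR.
    by apply: does_nop => //; split=> //; split=> // _ _; apply/r2.
  apply: does_do; split.
    by apply: keeps_trans k2V _; apply: eff_keeps.
  rewrite /= /upd /=; case: g2 => _ -> _ _; split=> // /(_ hS) h.
  by case/negP: hR; apply/r2.
move=> s2 [k2 b2].
do 2!apply: does_do_seq; set s3 := eff _ _.
have k3 : keeps V s s3.
  by do 2!apply: keeps_eff => //.
have b3 : trk s3 tBad = trk s2 tBad by [].
have t3 v : trk s3 tT v = (v == t_dst (tr k)).
  rewrite /s3 /= /upd /= (keeps_ptr (v := 10) k2) //; case: hcur => _ _ _ _ -> /=.
  by case: eqP.
apply: does_seq (does_keep (vs := tBad :: V) (does_saturate (VG _ _ k3 hg)) isT) _.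
move=> s4 [[g4 t4] k4].
apply: does_do_seq; set s5 := eff _ _.
have k5 : keeps (tBad :: V) s3 s5.
  by apply: keeps_trans k4 _; apply: eff_keeps.
have k5V : keeps V s s5.
  by apply: keeps_trans k3 _; apply: keeps_sub k5 => v hv; rewrite in_cons hv orbT.
have t5 v : trk s5 tT v = trk s4 tT v && (v \in bfin N).
  by rewrite /s5 /= /upd /= (keeps_trk (k := tF) k4) // (keeps_trk (k := tF) k3) // hF.
apply: does_seq (does_keep (vs := tBad :: V) (does_saturate (VG _ _ k5V hg)) isT) _.
move=> s6 [[g6 t6] k6].
have k6V : keeps V s s6.
  by apply: keeps_trans k5V _; apply: keeps_sub k6 => v hv; rewrite in_cons hv orbT.
have b6 : trk s6 tBad = trk s2 tBad.
  by rewrite (keeps_trk (k := tBad) k6) // (keeps_trk (k := tBad) k5).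
have q6 : ptr s6 (lQ outer) = t_src (tr k).
  by rewrite (keeps_ptr (v := 8) k6V) //; case: hcur.
have e3 : trk s3 tE = trk s tE by rewrite (keeps_trk (k := tE) k3).
have e5 : trk s5 tE = trk s tE by rewrite (keeps_trk (k := tE) k5V).
have T6 : trk s6 tT (t_src (tr k)) <-> exists f, [/\ f \in bfin N,
    conn (trk s tE) (t_dst (tr k)) f & conn (trk s tE) f (t_src (tr k))].
  rewrite t6 e5; split=> [[f]|[f [h1 h2 h3]]].
    rewrite t5 => /andP[/t4 [u]]; rewrite t3 e3 => /eqP -> hu hf hc.
    by exists f.
  exists f => //; rewrite t5 h1 andbT; apply/t4; exists (t_dst (tr k)); first by
    rewrite t3.
  by rewrite e3.
apply: does_if; rewrite (look_at _ q6 (ltn_q bq)) => hT.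
  apply: does_nop => //; split=> //; rewrite b6 b2 /good_edge; split=> [h|[]//].
  by split=> //; apply/T6.
apply: does_do; split.
  by apply: glob_keeps g6; apply: eff_keeps.
rewrite /= /upd /=; case: (g6) => _ -> _ _; split=> // -[_ /T6] h.
by rewrite h in hT.
Qed.

Definition prune_body : cmd :=
  If tE (lI outer) (Seq check (If tBad pZ
    (Seq (Do (Put tE (lI outer) false)) (raise outer)) nop)) nop.
Definition prune : cmd := fixloop outer prune_body.

(** As long as a set of mutually good transitions is contained in the current set, its members stay
    good there and cannot be pruned; this makes the result of pruning the greatest such set. *)
Lemma good_edge_mono (E E' : nat -> bool) k : (forall j, j < m -> E j -> E' j) ->
  good_edge E k -> good_edge E' k.
Proof.
move=> h [h1 [f [h2 h3 h4]]].
have hc u v : conn E u v -> conn E' u v.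
  elim=> [|v1 v2 _ IH [j [hj hE e1 e2]]]; first exact: conn_refl.
  by apply: conn_step IH _; exists j; split=> //; apply: h.
split=> [/h1 [j [j1 j2 j3 j4]]|]; first by exists j; split=> //; apply: h.
by exists f; split=> //; apply: hc.
Qed.

Lemma does_prune s : glob s -> (forall v, trk s tF v = (v \in bfin N)) ->
  does n prune s (fix_time (check_time + 4) n) (fun s' => [/\ glob s',
    forall k, k < m -> trk s' tE k -> trk s tE k /\ good_edge (trk s' tE) k &
    forall G : nat -> bool, (forall k, k < m -> G k -> trk s tE k /\ good_edge G k) ->
      forall k, k < m -> G k -> trk s' tE k]).
Proof.
move=> hg hF.
pose J s' := [/\ trk s' tF = trk s tF, forall k, k < m -> trk s' tE k -> trk s tE k &
  forall G : nat -> bool, (forall k, k < m -> G k -> trk s tE k /\ good_edge G k) ->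
      forall k, k < m -> G k -> trk s' tE k].
pose Cl k s' := trk s' tE k -> good_edge (trk s' tE) k.
pose mu s' := count (trk s' tE) (iota 0 m).
have ff := fun s1 s2 (k : keeps [:: tE; tF] s1 s2) => keeps_trk (k := tF) k isT.
have fe := fun s1 s2 (k : keeps [:: tE; tF] s1 s2) => keeps_trk (k := tE) k isT.
apply: does_conj (@does_fix outer prune_body [:: tE; tF] J Cl mu n (check_time + 4) s
  (or_introl erefl) _ _ _ isT isT _ hg _ _) _.
- by move=> s1 s2 k; rewrite /J (ff _ _ k) (fe _ _ k).
- by move=> j s1 s2 k; rewrite /Cl (fe _ _ k).
- by move=> s1 s2 k; rewrite /mu (fe _ _ k).
- move=> k s1 hk g1 [J1 J2 J3] c1; have ci : ptr s1 (lI outer) = k by case: c1.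
  rewrite addnS; apply: does_if; rewrite (look_at _ ci (ltn_m hk)) => hE; last first.
    apply: does_nop; first by rewrite addnC.
    left; split; first exact: keeps_refl.
    by split=> // hE'; rewrite hE' in hE.
  apply: does_seq (does_keep (vs := [:: tE; tF; lI outer; lH outer]) (does_check g1
    hk c1 _) isT) _.
    by move=> v; rewrite J1 hF.
  move=> s2 [[g2 b2] k2].
  have e2 : trk s2 tE = trk s1 tE by rewrite (keeps_trk (k := tE) k2).
  apply: does_if; rewrite (look_z _ g2) => hb.
    apply: does_do_seq; apply: does_do; right; split; rewrite ?/J ?/mu /= /upd /=.
    + rewrite (keeps_trk (k := tF) k2) // e2 (keeps_ptr (v := 7) k2) //.
      split=> // [j hj|G hG j hj Gj]; first by case: ifP => // _; apply: J2.
      case: eqP => [ej|_]; last exact: J3 Gj.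
      (* Here [j] would be a pruned member of [G]. It is good in [G], hence in the current set,
         while the raised flag says that it is not. *)
      rewrite -ci -ej in hb b2; suff /b2 : good_edge (trk s1 tE) j by rewrite hb.
      have [_] := hG j hj Gj; apply: good_edge_mono => i hi; exact: J3.
    + rewrite e2 (keeps_ptr (v := 7) k2) //; apply: (@count_iota_lt _ _ _ k) => //=.
        by move=> v; case: ifP.
      by rewrite ci eqxx.
    + by case: g2 => _ -> _ _.
  apply: does_nop => //; left; split; first by apply: keeps_sub k2 => v; rewrite !inE
    => /orP[]->; rewrite ?orbT.
  split; last by rewrite (keeps_trk (k := 25) k2).
  by move=> _; rewrite e2; apply/b2/negbTE.
- by split=> // G hG k hk /hG [].
- by apply: leq_trans (count_iota_le _ _) _; have [_ _ /ltnW] := enc_sizes N.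
move=> s' [g' [J1 J2 J3] hC]; split=> // k hk hE; split; first exact: J2.
exact: hC.
Qed.

End Program.

(** * Reachable states, parsing and the decision program *)

Section Decide.
Variable N : instance.
Hypothesis wfN : wf_instance N.
Notation x := (enc_instance N).
Notation n := (size (enc_instance N)).
Notation m := (size (bdelta N)).
Notation tr := (tr_of N).
Notation glob := (glob N).
Notation cur := (cur N).

Let ltn_q v : v < nQ N -> v < n.
Proof. by have [h _ _] := enc_sizes N => /ltn_trans; apply. Qed.
Let ltn_d v : v < nD N -> v < n.
Proof. by have [_ h _] := enc_sizes N => /ltn_trans; apply. Qed.
Let ltn_m v : v < m -> v < n.
Proof. by have [_ _ h] := enc_sizes N => /ltn_trans; apply. Qed.

Lemma tr_mem k : k < m -> tr k \in bdelta N.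
Proof. exact: mem_nth. Qed.

Lemma tr_eta k : tr k = (t_src (tr k), t_send (tr k), t_msg (tr k), t_dst (tr k)).
Proof. by case: (tr k) => [[[]]]. Qed.

(** One command for sends and receives: a receive is marked only when its message is already in
    [tM], so adding the message again changes nothing. The tests around it ensure that some new
    message or state is added, which lowers the measure. *)
Definition mark : cmd :=
  Seq (Do (Put tM (lA outer) true)) (Seq (Do (Put tS (lR outer) true)) (raise outer)).
Definition mark_new : cmd := If tS (lR outer) nop mark.
Definition spread_body : cmd :=
  If tS (lQ outer) (If (lB outer) pZ (If tM (lA outer) mark_new mark)
                                     (If tM (lA outer) mark_new nop)) nop.
Definition spread : cmd := fixloop outer spread_body.

Lemma does_spread s : glob s -> (forall v, trk s tS v = (v \in binit N)) ->
  (forall v, trk s tM v = false) ->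
  does n spread s (fix_time N 7 (n + n)) (fun s' => glob s' /\
    forall v, trk s' tS v <-> reach N v).
Proof.
move=> hg hS hM.
pose J s' := [/\ forall v, v \in binit N -> trk s' tS v,
   forall v, trk s' tS v -> reach N v &
   forall a, trk s' tM a -> exists p p', reach N p /\ (p, true, a, p') \in bdelta N].
pose Cl k s' := trk s' tS (t_src (tr k)) ->
  (t_send (tr k) -> trk s' tM (t_msg (tr k)) /\ trk s' tS (t_dst (tr k))) /\
  (~~ t_send (tr k) -> trk s' tM (t_msg (tr k)) -> trk s' tS (t_dst (tr k))).
pose mu s' := count (fun v => ~~ trk s' tS v) (iota 0 (nQ N)) +
              count (fun v => ~~ trk s' tM v) (iota 0 (nD N)).
have fs := fun s1 s2 (k : keeps [:: tS; tM] s1 s2) => keeps_trk (k := tS) k isT.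
have fm := fun s1 s2 (k : keeps [:: tS; tM] s1 s2) => keeps_trk (k := tM) k isT.
apply: does_conj (@does_fix N outer spread_body [:: tS; tM] J Cl mu (n + n) 7 s
  (or_introl erefl) _ _ _ isT isT _ hg _ _) _.
- by move=> s1 s2 k; rewrite /J (fs _ _ k) (fm _ _ k).
- by move=> j s1 s2 k; rewrite /Cl (fs _ _ k) (fm _ _ k).
- by move=> s1 s2 k; rewrite /mu (fs _ _ k) (fm _ _ k).
- move=> k s1 hk g1 [J1 J2 J3] [ci cq cb ca cr].
  have [bq ba br] := tr_bounds wfN hk.
  have keep s2 : s2 = s1 -> Cl k s1 ->
      keeps [:: tS; tM] s1 s2 /\ Cl k s2 /\ trk s2 (lH outer) 0 = trk s1 (lH outer) 0.
    by move=> ->.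
  have hmem := tr_mem hk; rewrite tr_eta in hmem.
  have markP : trk s1 tS (t_src (tr k)) ->
     (t_send (tr k) \/ trk s1 tM (t_msg (tr k))) ->
     ~~ (trk s1 tM (t_msg (tr k)) && trk s1 tS (t_dst (tr k))) ->
     does n mark s1 3 (fun s' => [/\ J s', mu s' < mu s1 & trk s' (lH outer) 0]).
    move=> hQ hor hnew.
    do 2!apply: does_do_seq; apply: does_do; split; rewrite ?/J ?/mu /= /upd /=.
    + rewrite ca cr; split=> v; first by case: eqP => // _ /J1.
      * case: eqP => [-> _|_ /J2//].
        have hr := J2 _ hQ.
        case: hor => h; first by apply: reach_send hr _; move: hmem; rewrite h; apply.
        case: (boolP (t_send (tr k))) => hs.
          by apply: reach_send hr _; move: hmem; rewrite hs; apply.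
        have [p [p' [hp hp']]] := J3 _ h.
        by apply: reach_recv hp hp' hr _; move: hmem; rewrite (negbTE hs).
      * case: eqP => [-> _|_ /J3//].
        case: hor => h; last exact: J3.
        exists (t_src (tr k)), (t_dst (tr k)); split; first exact: J2.
        by move: hmem; rewrite h.
    + rewrite ca cr; rewrite negb_and in hnew.
      have hs1 : subpred (fun v => ~~ (if v == t_dst (tr k) then true else trk s1 tS v))
                   (fun v => ~~ trk s1 tS v) by move=> v; case: eqP.
      have hs2 : subpred (fun v => ~~ (if v == t_msg (tr k) then true else trk s1 tM v))
                   (fun v => ~~ trk s1 tM v) by move=> v; case: eqP.
      case/orP: hnew => hnew.
        apply: (leq_ltn_trans (leq_add (sub_count hs1 _) (leqnn _))).
        by rewrite ltn_add2l; apply: (@count_iota_lt _ _ _ (t_msg (tr k))) => //=;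
          rewrite eqxx.
      apply: (leq_ltn_trans (leq_add (leqnn _) (sub_count hs2 _))).
      by rewrite ltn_add2r; apply: (@count_iota_lt _ _ _ (t_dst (tr k))) => //=;
        rewrite eqxx.
    + by case: g1 => _ -> _ _.
  apply: does_if; rewrite (look_at _ cq (ltn_q bq)) => hQ; last first.
    by apply: does_nop => //; left; apply: keep => // hQ'; rewrite hQ' in hQ.
  apply: does_if; rewrite (look_z _ g1) cb => hB.
    apply: does_if; rewrite (look_at _ ca (ltn_d ba)) => hA.
      apply: does_if; rewrite (look_at _ cr (ltn_q br)) => hR.
        by apply: does_nop => //; left; apply: keep => // _; split.
      apply: does_le (markP hQ _ _) _ _ => //; [by left|by rewrite hA|by move=> s2;
        right].
    apply: does_le (markP hQ _ _) _ _ => //; [by left|by rewrite (negbTE hA)|by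
      move=> s2; right].
  apply: does_if; rewrite (look_at _ ca (ltn_d ba)) => hA.
    apply: does_if; rewrite (look_at _ cr (ltn_q br)) => hR.
      by apply: does_nop => //; left; apply: keep => // _; split=> // h; rewrite h in
        hB.
    apply: does_le (markP hQ _ _) _ _ => //; [by right|by rewrite hA|by move=> s2;
      right].
  apply: does_nop => //; left; apply: keep => // _.
  by split=> [h|_ h]; [rewrite h in hB|rewrite h in hA].
- split=> [v|v|a]; rewrite ?hS ?hM //; exact: reach_init.
- by apply: leq_add; apply: leq_trans (count_iota_le _ _) _; have [/ltnW ? /ltnW ? _]
    := enc_sizes N.
move=> s' [g' [J1 J2 J3] hC]; split=> // v; split; first exact: J2.
have at_tr t : t \in bdelta N -> exists2 k, k < m & tr k = t.
  by move=> ht; exists (index t (bdelta N)); rewrite ?index_mem // /tr_of nth_index.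
elim=> {v} [v hv|q a q' _ IH /at_tr [k hk e]|p a p' q q' _ IHp /at_tr [k hk e] _ IHq
  /at_tr [k' hk' e']].
- exact: J1.
- by have := hC k hk; rewrite /Cl e => /(_ IH) [/(_ isT) []].
have := hC k hk; rewrite /Cl e => /(_ IHp) [/(_ isT) [hM' _] _].
by have := hC k' hk'; rewrite /Cl e' => /(_ IHq) [_ /(_ isT hM')].
Qed.

(** A length is read into the scratch pointer 8 just to step over it; a copy of the pointer saved in
    front of it (5, [pC] or 11) later meters the entries. The idle pass [edges outer nop] skips the
    transitions and leaves pointer 6, which is [lP outer], at the final states. *)
Definition parse : cmd :=
  Seq (Do (Zero pZ)) (Seq (Do (Zero p0)) (Seq (read p0 8) (Seq (read p0 8)
  (Seq (Do (Clear tS)) (Seq (Do (Copy 5 p0)) (Seq (read p0 8) (Seq (read_set 5 p0 8 tS)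
  (Seq (Do (Copy pC p0)) (Seq (read p0 8) (Seq (Do (Copy pD p0)) (Seq (edges outer nop)
  (Seq (Do (Clear tF)) (Seq (Do (Copy 11 6)) (Seq (read 6 8) (read_set 11 6 8
    tF))))))))))))))).

Definition parse_time : nat := 5 * (3 * n + 3) + 2 * (n * (3 * n + 6) + 1) +
  edges_time N 1 + 20.

Lemma does_parse s : inp x s ->
  does n parse s parse_time (fun s' => [/\ glob s',
    forall v, trk s' tS v = (v \in binit N) & forall v, trk s' tF v = (v \in bfin N)]).
Proof.
move=> hi.
set RD := 3 * n + 3; set RS := n * (3 * n + 6) + 1.
apply: (@does_time _ _ _ (RD + (RD + (RD + (RS + (RD + (edges_time N 1 + (RD +
  RS).+2).+1).+1)).+2)).+2).
  by rewrite /parse_time -/RD -/RS; lia.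
set r1 := enc_list enc_nat (binit N) ++ enc_list enc_trans (bdelta N) ++ enc_list
  enc_nat (bfin N).
do 2!apply: does_do_seq; set s1 := eff _ _.
have base1 : inp x s1 /\ ptr s1 pZ = 0 by [].
have p1 : strm x s1 p0 (enc_nat (nQ N) ++ enc_nat (nD N) ++ r1).
  by rewrite /strm /= /upd /= drop0.
have baseK s2 s3 : keeps [:: tX; pZ] s2 s3 -> inp x s2 /\ ptr s2 pZ = 0 -> inp x s3
  /\ ptr s3 pZ = 0.
  by move=> k [h1 h2]; split; [apply: (inp_keeps k)|rewrite (keeps_ptr k)].
apply: does_seq (does_keep (vs := [:: tX; pZ]) (@does_read x p0 8 s1 _ _ isT isT isT
  base1.1 p1) isT) _.
move=> s2 [[p2 _] /baseK /(_ base1) base2].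
apply: does_seq (does_keep (vs := [:: tX; pZ]) (@does_read x p0 8 s2 _ _ isT isT isT
  base2.1 p2) isT) _.
move=> s3 [[p3 _] /baseK /(_ base2) base3].
do 2!apply: does_do_seq; set s4 := eff _ _.
have base4 : inp x s4 /\ ptr s4 pZ = 0 by case: base3.
have c4 : strm x s4 5 r1 by rewrite /strm /= /upd.
have p4 : strm x s4 p0 r1 by rewrite /strm /= /upd.
have S4 v : trk s4 tS v = false by rewrite /= /upd.
rewrite /r1 /enc_list -!catA in c4 p4.
apply: does_seq (does_keep (vs := [:: tX; pZ; tS; 5]) (@does_read x p0 8 s4 _ _ isT
  isT isT base4.1 p4) isT) _.
move=> s5 [[p5 _] k5].
have base5 : inp x s5 /\ ptr s5 pZ = 0.
  by apply: baseK base4; apply: keeps_sub k5 => v; rewrite !inE => /orP[]->; rewrite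
    ?orbT.
have c5 := strm_keeps (p := 5) k5 isT c4.
apply: does_seq (does_keep (vs := [:: tX; pZ]) (@does_read_set x 5 p0 8 tS s5 _ _ _
  isT base5.1 c5 p5) isT) _.
move=> s6 [[p6 S6'] /baseK /(_ base5) base6].
have S6 v : trk s6 tS v = (v \in binit N) by rewrite S6' (keeps_trk (k := tS) k5) // S4.
apply: does_do_seq; set s7 := eff _ _.
have base7 : inp x s7 /\ ptr s7 pZ = 0 by case: base6.
have p7 : strm x s7 p0 (enc_nat m ++ delta_code N 0).
  by rewrite /delta_code drop0 /fin_code /enc_list -?catA; exact: p6.
have c7 : strm x s7 pC (enc_nat m ++ delta_code N 0) by exact: p7.
apply: does_seq (does_keep (vs := [:: tX; pZ; pC; tS]) (@does_read x p0 8 s7 _ _ isT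
  isT isT base7.1 p7) isT) _.
move=> s8 [[p8 _] k8].
apply: does_do_seq; set s9 := eff _ _.
have g9 : glob s9.
  split.
  - by move=> j; rewrite /= (keeps_trk (k := tX) k8) //; case: base7.
  - by rewrite /= /upd /= (keeps_ptr (v := pZ) k8) //; case: base7.
  - by have := strm_keeps (p := pC) k8 isT c7.
  - exact: p8.
have S9 v : trk s9 tS v = (v \in binit N).
  by rewrite /= (keeps_trk (k := tS) k8) //; apply: S6.
apply: does_seq.
  apply: (@does_edges N outer nop [:: tS] (fun _ s' => trk s' tS = trk s9 tS) 1 s9
    (or_introl erefl) _ isT isT _ g9 erefl).
    by move=> k s' s'' kk e; rewrite (keeps_trk (k := tS) kk).
  by move=> k s' _ _ e _; apply: does_nop.
move=> s10 [g10 S10 p10].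
do 2!apply: does_do_seq; set s11 := eff _ _.
have g11 : glob s11 by apply: glob_keeps g10; do 2!apply: keeps_eff => //.
have c11 : strm x s11 11 (fin_code N) by exact: p10.
have p11 : strm x s11 6 (fin_code N) by exact: p10.
rewrite /fin_code /enc_list in c11 p11; rewrite -[flatten _]cats0 in c11 p11.
have i11 : inp x s11 by case: g11.
apply: does_seq (does_keep (vs := [:: tS; tF; 11] ++ gvars) (@does_read x 6 8 s11 _ _
  isT isT isT i11 p11) isT) _.
move=> s12 [[p12 _] k12].
have g12 : glob s12 by apply: glob_keeps g11; apply: keeps_sub k12 => v hv; rewrite
  mem_cat hv orbT.
have c12 := strm_keeps (p := 11) k12 isT c11.
have i12 : inp x s12 by case: g12.
apply: does_conj (does_keep (vs := tS :: gvars) (@does_read_set x 11 6 8 tF s12 _ _ _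
  isT i12 c12 p12) isT) _.
move=> s13 [[_ F13] k13]; split.
- by apply: glob_keeps g12; apply: keeps_sub k13 => v hv; rewrite in_cons hv orbT.
- move=> v; rewrite (keeps_trk (k := tS) k13) // (keeps_trk (k := tS) k12) //.
  by rewrite -S9 -S10.
- by move=> v; rewrite F13 (keeps_trk (k := tF) k12).
Qed.

Definition enable_body : cmd := If tS (lQ outer) (Do (Put tE (lI outer) true)) nop.
Definition enable : cmd := edges outer enable_body.
Definition seek_body : cmd := If tE (lI outer) (Do (Put tR pZ true)) nop.
Definition seek : cmd := edges outer seek_body.

Lemma does_enable s : glob s -> (forall k, trk s tE k = false) ->
  does n enable s (edges_time N 2) (fun s' => glob s' /\
    forall k, k < m -> trk s' tE k = trk s tS (t_src (tr k))).
Proof.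
move=> hg hE.
pose Inv j s' := trk s' tS = trk s tS /\
  forall k, trk s' tE k = (k < j) && trk s tS (t_src (tr k)).
apply: does_conj (@does_edges N outer enable_body [:: tE; tS] Inv 2 s (or_introl
  erefl) _ isT isT _ hg _) _.
- move=> j s2 s3 kk; rewrite /Inv (keeps_trk (k := tE) kk isT).
  by rewrite (keeps_trk (k := tS) kk isT).
- move=> j s2 hj g2 [J1 J2] [ci cq cb ca cr].
  have [bq _ _] := tr_bounds wfN hj.
  apply: does_if; rewrite (look_at _ cq (ltn_q bq)) J1 => hS.
    apply: does_do; split=> // k; rewrite /= /upd /= ci J2 ltnS [k <= j]leq_eqVlt.
    by case: eqP => [->|//]; rewrite hS.
  apply: does_nop => //; split=> // k; rewrite J2 ltnS [k <= j]leq_eqVlt.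
  by case: eqP => [->|//]; rewrite (negbTE hS) !andbF.
- by split=> // k; rewrite hE.
by move=> s' [g' [_ h] _]; split=> // k hk; rewrite h hk.
Qed.

Lemma does_seek s : glob s -> trk s tR 0 = false ->
  does n seek s (edges_time N 2) (fun s' => glob s' /\
    (trk s' tR 0 <-> exists2 k, k < m & trk s tE k)).
Proof.
move=> hg hR.
pose Inv j s' := trk s' tE = trk s tE /\
  (trk s' tR 0 <-> exists2 k, k < j & trk s tE k).
apply: does_conj (@does_edges N outer seek_body [:: tE; tR] Inv 2 s (or_introl erefl)
  _ isT isT _ hg _) _.
- move=> j s2 s3 kk; rewrite /Inv (keeps_trk (k := tE) kk isT).
  by rewrite (keeps_trk (k := tR) kk isT).
- move=> j s2 hj g2 [J1 J2] [ci cq cb ca cr].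
  apply: does_if; rewrite (look_at _ ci (ltn_m hj)) J1 => hE.
    apply: does_do; split=> //=; rewrite /upd /=; case: g2 => _ -> _ _.
    by split=> // _; exists j.
  apply: does_nop => //; split=> //; rewrite J2; split=> [] [k hk hk'].
    by exists k => //; apply: leqW.
  exists k => //; move: hk; rewrite ltnS leq_eqVlt => /orP[/eqP e|//].
  by rewrite -e hk' in hE.
- by split=> //; rewrite hR; split=> // -[].
by move=> s' [g' [_ h] _]; split.
Qed.

Definition decide : cmd :=
  Seq parse (Seq (Do (Clear tM)) (Seq spread (Seq (Do (Clear tE)) (Seq enable
  (Seq prune (Seq (Do (Clear tR)) seek)))))).

Definition decide_time : nat :=
  parse_time + (fix_time N 7 (n + n) + (edges_time N 2 + (fix_time N (check_time N +
    4) n +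
    (edges_time N 2).+1)).+1).+1.

Definition live_edges (E : nat -> bool) : Prop :=
  forall k, k < m -> E k -> reach N (t_src (tr k)) /\ good_edge N E k.

Lemma does_decide s : inp x s ->
  does n decide s decide_time (fun s' => glob s' /\
    (trk s' tR 0 <-> exists E, live_edges E /\ exists2 k, k < m & E k)).
Proof.
move=> hi; apply: does_seq (does_parse hi) _ => s1 [g1 S1 F1].
apply: does_do_seq; set s2 := eff _ _.
have g2 : glob s2 by apply: glob_keeps g1; apply: keeps_eff.
apply: does_seq (does_keep (vs := [:: tF]) (@does_spread s2 g2 S1 (fun=> erefl)) isT) _.
move=> s3 [[g3 S3] k3].
apply: does_do_seq; set s4 := eff _ _.
have g4 : glob s4 by apply: glob_keeps g3; apply: keeps_eff.
apply: does_seq (does_keep (vs := [:: tF]) (does_enable g4 (fun=> erefl)) isT) _.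
move=> s5 [[g5 E5] k5].
have F5 v : trk s5 tF v = (v \in bfin N).
  rewrite (keeps_trk (k := tF) k5) // -[trk s4 tF]/(trk s3 tF).
  by rewrite (keeps_trk (k := tF) k3) //; apply: F1.
apply: does_seq (does_prune wfN g5 F5) _ => s6 [g6 E6 G6].
apply: does_do_seq; set s7 := eff _ _.
have g7 : glob s7 by apply: glob_keeps g6; apply: keeps_eff.
apply: does_conj (does_seek g7 erefl) _ => s8 [g8 R8]; split=> //.
rewrite R8; split=> [[k hk hE]|[G [hG [k hk hE]]]].
  exists (trk s6 tE); split; last by exists k.
  move=> j hj hj'; have [h1 h2] := E6 j hj hj'; split=> //.
  by move: h1; rewrite E5 // => /S3.
exists k => //; apply: (G6 G) => // j hj Gj; have [h1 h2] := hG j hj Gj; split=> //.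
by rewrite E5 //; apply/S3.
Qed.

End Decide.

Definition program : cmd := Seq decide (Do (Look tR pZ)).

Lemma wf_program : wf_cmd np w'.+1 program.
Proof. by []. Qed.

(** * Fair computations and live sets of transitions *)

(** Each entry of the list that does not recur has a last occurrence; the list being finite, [M] can
    be chosen beyond all of them. *)
Lemma eventually_recurrent (T : eqType) (l : seq T) (P : T -> nat -> Prop) :
  exists M, forall t j, t \in l -> M <= j -> P t j ->
    forall M', exists2 j', M' <= j' & P t j'.
Proof.
elim: l => [|t l [M hM]]; first by exists 0.
case: (classic (forall M', exists2 j', M' <= j' & P t j')) => [h|h].
  exists M => t' j; rewrite inE => /orP[/eqP-> _ _|h1 h2 h3]; first exact: h.
  exact: hM h1 h2 h3.
have {h} [M1 h1] : exists M1, forall j, M1 <= j -> ~ P t j.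
  apply: NNPP => h2; apply: h => M'; apply: NNPP => h3; apply: h2.
  by exists M' => j hj hP; apply: h3; exists j.
exists (maxn M M1) => t' j; rewrite inE geq_max => /orP[/eqP->|h] /andP[hj hj1] hP.
  by case: (h1 j hj1).
exact: hM h hj hP.
Qed.

Section Characterization.
Variable N : instance.
Notation m := (size (bdelta N)).
Notation tr := (tr_of N).
Notation conn := (conn N).
Notation reach := (reach N).

Lemma edge_index t : t \in bdelta N -> exists2 k, k < m & tr k = t.
Proof.
by move=> ht; exists (index t (bdelta N)); rewrite ?index_mem // /tr_of nth_index.
Qed.

(** * From a fair computation to a live set of transitions *)

Section Forward.
Variables (K : nat) (cfg : nat -> 'I_K -> nat) (msg : nat -> nat) (typ : nat -> {set
  'I_K}).
Hypothesis init0 : forall i, cfg 0 i \in binit N.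
Hypothesis step : forall j, bstep (inst_delta N) (cfg j) (cfg j.+1) (msg j) (typ j).
Hypothesis fair : forall i : 'I_K, (forall M, exists2 j, M <= j & i \in typ j) ->
  forall M, exists2 j, M <= j & cfg j i \in bfin N.

(** Source, target and message are matched, but not the direction: whatever the direction, the step
    has a sending transition for that message, and this is what receivability asks for. *)
Definition takes (p : 'I_K * nat) (j : nat) : Prop :=
  [/\ p.1 \in typ j, t_src (tr p.2) = cfg j p.1, t_dst (tr p.2) = cfg j.+1 p.1 &
      t_msg (tr p.2) = msg j].

Lemma reach_cfg j i : reach (cfg j i).
Proof.
elim: j i => [|j IH] i; first exact: reach_init.
case: (step j) => i0 [h0 hs hr hi]; have [hT|hT] := boolP (i \in typ j); last by
  rewrite -hi.
have [->|ne] := eqVneq i i0; first exact: reach_send (IH i0) hs.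
exact: reach_recv (IH i0) hs (IH i) (hr i hT ne).
Qed.

Lemma sender_takes j : exists i k, [/\ k < m, t_send (tr k) & takes (i, k) j].
Proof.
case: (step j) => i0 [h0 /edge_index [k hk e] _ _].
by exists i0, k; rewrite /takes e.
Qed.

Lemma mover_takes j i : i \in typ j -> exists2 k, k < m & takes (i, k) j.
Proof.
case: (step j) => i0 [h0 hs hr _] hi; have [e0|ne] := eqVneq i i0.
  by move: hs => /edge_index [k hk e]; exists k => //; rewrite /takes e /= e0.
by have /edge_index [k hk e] := hr i hi ne; exists k => //; rewrite /takes e.
Qed.

Lemma live_edges_of_computation : exists E, live_edges N E /\ exists2 k, k < m & E k.
Proof.
pose inf p := forall M, exists2 j, M <= j & takes p j.
pose E k := if excluded_middle_informative (exists i, inf (i, k)) then true else false.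
have EP k : E k <-> exists i, inf (i, k).
  by rewrite /E; case: excluded_middle_informative.
have [M0 hM] := eventually_recurrent (allpairs pair (enum 'I_K) (iota 0 m)) takes.
have hE i k j : k < m -> M0 <= j -> takes (i, k) j -> E k.
  move=> hk hj ht; apply/EP; exists i; apply: hM hj ht.
  by apply: allpairs_f; rewrite ?mem_enum // mem_iota.
have hconn i a b : M0 <= a -> a <= b -> conn E (cfg a i) (cfg b i).
  move=> ha /subnK <-; elim: (b - a) => [|d IH]; first exact: conn_refl.
  rewrite addSn; have [hi|hi] := boolP (i \in typ (d + a)).
    have [k hk ht] := mover_takes hi.
    apply: conn_step IH _; exists k; case: (ht) => _ h1 h2 _; split=> //.
    by apply: hE ht => //; apply: leq_trans (leq_addl _ _).
  by case: (step (d + a)) => i0 [_ _ _ /(_ i hi) <-].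
exists E; split; last first.
  have [i [k [hk _ ht]]] := sender_takes M0.
  by exists k => //; apply: hE ht.
move=> k hk /EP [i hi]; have [j0 hj0 ht0] := hi M0.
have [_ e1 e2 e3] := ht0; split; first by rewrite e1; apply: reach_cfg.
split=> [_|].
  (* The step [j0] lies beyond [M0], so the transition of its sender is recurrent as well and
     belongs to [E]. *)
  have [i' [k' [hk' hs' ht']]] := sender_takes j0.
  exists k'; split=> //; first exact: hE ht'.
  by case: ht' => _ _ _ ->; rewrite e3.
have hinf M : exists2 j, M <= j & i \in typ j.
  by have [j hj [h _ _ _]] := hi M; exists j.
(* The client uses the transition at [j0] and again at [j2], and fairness puts a final state in
   between, at [j1]. Beyond [M0] its trajectory is an [E]-walk, which yields the closed walk. *)
have [j1 hj1 hf] := fair hinf j0.+1.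
have [j2 hj2 [_ e4 _ _]] := hi j1.
exists (cfg j1 i); split=> //; first by rewrite e2; apply: hconn => //; apply: leqW.
by rewrite e4; apply: hconn => //; apply: leq_trans hj0 (ltnW hj1).
Qed.
End Forward.

(** * Combining finite populations of clients *)

Definition gstep (X : finType) (c c' : X -> nat) (a : nat) (T : {set X}) : Prop :=
  exists i : X,
    [/\ i \in T, inst_delta N (c i) (Send a) (c' i),
        (forall j, j \in T -> j != i -> inst_delta N (c j) (Recv a) (c' j)) &
        (forall j, j \notin T -> c j = c' j)].

Definition fair_from (X : finType) (c : X -> nat) : Prop :=
  exists (cfg : nat -> X -> nat) (msg : nat -> nat) (typ : nat -> {set X}),
    [/\ cfg 0 =1 c, (forall j, gstep (cfg j) (cfg j.+1) (msg j) (typ j)) &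
        (forall i : X, (forall M, exists2 j, M <= j & i \in typ j) ->
           forall M, exists2 j, M <= j & cfg j i \in bfin N)].

Inductive grun (X : finType) : (X -> nat) -> (X -> nat) -> Prop :=
  | grun_refl c : grun c c
  | grun_step c c1 c2 a T : gstep c c1 a T -> grun c1 c2 -> grun c c2.

Lemma grun_trans (X : finType) (c c1 c2 : X -> nat) : grun c c1 -> grun c1 c2 -> grun
  c c2.
Proof. by elim=> // {}c c' c'' a T h _ IH /IH; apply: grun_step h. Qed.

(** Arbitrary finite types of clients let populations be joined by sums; the numbering by ordinals
    is restored only here. *)
Lemma fair_live_of_finType (X : finType) (c : X -> nat) :
  (forall y, c y \in binit N) -> fair_from c -> fair_live N.
Proof.
move=> hi [cfg [msg [typ [h0 hs hf]]]].
exists #|X|, (fun j i => cfg j (enum_val i)), msg, (fun j => [set i | enum_val i \in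
  typ j]); split.
- by move=> i; rewrite h0.
- move=> j; have [i0 [h1 h2 h3 h4]] := hs j; exists (enum_rank i0); split.
  + by rewrite inE enum_rankK.
  + by rewrite enum_rankK.
  + move=> i; rewrite inE => hi' ne; apply: h3 => //; apply: contraNneq ne => <-.
    by rewrite enum_valK.
  + by move=> i; rewrite inE => /h4.
- move=> i hinf M; apply: hf => M'; have [j hj] := hinf M'; rewrite inE; by exists j.
Qed.

Lemma fair_from_run (X : finType) (c c' : X -> nat) :
  grun c c' -> fair_from c' -> fair_from c.
Proof.
elim=> // {c'}c c1 c2 a T [i [h1 h2 h3 h4]] _ IH /IH [cfg [msg [typ [e0 hs hf]]]].
exists (fun j => if j is j'.+1 then cfg j' else c), (fun j => if j is j'.+1 then msg
  j' else a),
  (fun j => if j is j'.+1 then typ j' else T); split=> //.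
- case=> [|j]; last exact: hs.
  exists i; split=> //.
  + by rewrite e0.
  + by move=> j hj ne; rewrite e0; apply: h3.
  + by move=> j hj; rewrite e0; apply: h4.
- move=> y hy M; have [|j hj hj'] := hf y _ M; last by exists j.+1 => //; apply: leqW.
  by move=> M'; have [[//|j] hj hj'] := hy M'.+1; exists j.
Qed.

Definition csum (X Y : finType) (c : X -> nat) (d : Y -> nat) (z : X + Y) : nat :=
  match z with inl u => c u | inr v => d v end.

(** A broadcast may be ignored by any client, so one population can run while the other stands
    still. *)
Lemma grun_inl (X Y : finType) (c c' : X -> nat) (d : Y -> nat) :
  grun c c' -> grun (csum c d) (csum c' d).
Proof.
elim=> {c c'} [c|c c1 c2 a T [i [h1 h2 h3 h4]] _ IH]; first exact: grun_refl.
apply: (grun_step (a := a) (T := [set z | if z is inl u then u \in T else false]) _ IH).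
exists (inl i); split; rewrite ?inE //.
- by case=> [u|v]; rewrite inE //= => hu ne; apply: h3.
- by case=> [u|v]; rewrite inE //=; apply: h4.
Qed.

Lemma grun_inr (X Y : finType) (c : X -> nat) (d d' : Y -> nat) :
  grun d d' -> grun (csum c d) (csum c d').
Proof.
elim=> {d d'} [d|d d1 d2 a T [i [h1 h2 h3 h4]] _ IH]; first exact: grun_refl.
apply: (grun_step (a := a) (T := [set z | if z is inr u then u \in T else false]) _ IH).
exists (inr i); split; rewrite ?inE //.
- by case=> [u|v]; rewrite inE //= => hu ne; apply: h3.
- by case=> [u|v]; rewrite inE //=; apply: h4.
Qed.

Definition coverable (q : nat) : Prop :=
  exists (Z : finType) (z : Z) (c0 c : Z -> nat),
    [/\ forall y, c0 y \in binit N, grun c0 c & c z = q].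

Definition cset (X : finType) (c : X -> nat) (z : X) (q : nat) (y : X) : nat :=
  if y == z then q else c y.

(** For a receive, the population providing the sender and the one providing the receiver are run
    side by side; the chosen client of the former then broadcasts to that of the latter. *)
Lemma reach_coverable q : reach q -> coverable q.
Proof.
elim=> {q} [q hq|q a q' _ [Z [z [c0 [c [hi hr hz]]]]] hd|p a p' q q' _ [Z1 [z1 [c01
  [c1 [hi1 hr1 hz1]]]]] hp _ [Z2 [z2 [c02 [c2 [hi2 hr2 hz2]]]]] hq].
- by exists unit, tt, (fun=> q), (fun=> q); split=> //; apply: grun_refl.
- exists Z, z, c0, (cset c z q'); split=> //; last by rewrite /cset eqxx.
  apply: grun_trans hr _; apply: (grun_step (a := a) (T := [set z])) (grun_refl _).
  exists z; split; rewrite ?inE //.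
  + by rewrite /cset eqxx /= hz.
  + by move=> j; rewrite inE => ->.
  + by move=> j; rewrite inE /cset => /negbTE->.
exists (Z1 + Z2)%type, (inr z2), (csum c01 c02), (cset (cset (csum c1 c2) (inl z1)
  p') (inr z2) q'); split.
- by case.
- apply: grun_trans (grun_inl _ hr1) _; apply: grun_trans (grun_inr _ hr2) _.
  apply: (grun_step (a := a) (T := [set inl z1; inr z2])) (grun_refl _).
  exists (inl z1); split; rewrite ?inE ?eqxx //.
  + by rewrite /cset eqxx /= hz1.
  + by move=> j; rewrite !inE => /orP[->//|/eqP-> _]; rewrite /cset eqxx /= hz2.
  + by move=> j; rewrite !inE negb_or => /andP[/negbTE h1 /negbTE h2]; rewrite /cset
      h1 h2.
- by rewrite /cset eqxx.
Qed.

Lemma reach_binit q : reach q -> exists q0, q0 \in binit N.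
Proof. by elim=> // {}q hq; exists q. Qed.

(** Injectivity of [f] gives repeated states of [ts] different clients. The initial state [q0] fills
    a one-client population when [ts] is empty, as [f] needs a nonempty codomain. *)
Lemma coverable_seq (q0 : nat) (ts : seq nat) : q0 \in binit N ->
  (forall q, q \in ts -> reach q) ->
  exists (Z : finType) (f : nat -> Z) (c0 c : Z -> nat),
    [/\ forall y, c0 y \in binit N, grun c0 c,
        {in gtn (size ts) &, injective f} & forall i, i < size ts -> c (f i) = nth 0
          ts i].
Proof.
move=> h0; elim: ts => [|q ts IH] hts.
  by exists unit, (fun=> tt), (fun=> q0), (fun=> q0); split=> //; apply: grun_refl.
have [|Z2 [f [c02 [c2 [hi2 hr2 hf2 hc2]]]]] := IH.
  by move=> p hp; apply: hts; rewrite inE hp orbT.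
have [|Z1 [z1 [c01 [c1 [hi1 hr1 hz1]]]]] := @reach_coverable q.
  by apply: hts; rewrite inE eqxx.
exists (Z1 + Z2)%type, (fun i => if i is j.+1 then inr (f j) else inl z1), (csum c01
  c02), (csum c1 c2); split.
- by case.
- by apply: grun_trans (grun_inl _ hr1) (grun_inr _ hr2).
- move=> [|i] [|j] //= hi hj [/hf2 e]; congr _.+1; exact: e.
- by case=> [|i] //=; rewrite ltnS => /hc2.
Qed.

(** Despite the name there is no stem: [w] is a cyclic sequence of transition indices. *)
Definition lasso (E : nat -> bool) (k : nat) (w : seq nat) : Prop :=
  [/\ 0 < size w, nth 0 w 0 = k,
      forall i, i < size w -> nth 0 w i < m /\ E (nth 0 w i),
      forall i, i < size w -> t_dst (tr (nth 0 w i)) = t_src (tr (nth 0 w (i.+1 %%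
        size w))) &
      exists2 o, o < size w & t_src (tr (nth 0 w o)) \in bfin N].

Fixpoint walk (u : nat) (p : seq nat) (v : nat) : bool :=
  if p is i :: p' then (t_src (tr i) == u) && walk (t_dst (tr i)) p' v else u == v.

Lemma walk_cat u p q v v' : walk u p v -> walk v q v' -> walk u (p ++ q) v'.
Proof.
by elim: p u => [|i p IH] u /=; [move=> /eqP->|move=> /andP[-> /IH h] /h].
Qed.

Lemma conn_walk E u v : conn E u v ->
  exists2 p, walk u p v & forall i, i \in p -> i < m /\ E i.
Proof.
elim=> {v} [|v v' _ [p hp hE] [k [hk Ek e1 e2]]]; first by exists [::] => /=.
exists (p ++ [:: k]).
  by apply: walk_cat hp _; rewrite /= e1 e2 !eqxx.
by move=> i; rewrite mem_cat inE => /orP[/hE|/eqP->].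
Qed.

Lemma walk_nth u p v i : walk u p v -> i < size p ->
  t_dst (tr (nth 0 p i)) = if i.+1 < size p then t_src (tr (nth 0 p i.+1)) else v.
Proof.
elim: p u i => [|k p IH] u [|i] //= /andP[_ h].
  by case: p h {IH} => [|k' p] /=; [move/eqP|case/andP=> /eqP].
by rewrite ltnS => hi; rewrite (IH _ _ h hi) ltnS.
Qed.

Lemma exists_lasso (E : nat -> bool) k : k < m -> E k -> good_edge N E k -> exists w,
  lasso E k w.
Proof.
move=> hk hE [_ [f [hf /conn_walk [p hp pE] /conn_walk [q hq qE]]]].
have hw : walk (t_src (tr k)) (k :: p ++ q) (t_src (tr k)).
  by rewrite /= eqxx /=; apply: walk_cat hp hq.
exists (k :: p ++ q); split=> //.
- move=> i hi; have := mem_nth 0 hi; rewrite inE mem_cat => /orP[/eqP->//|].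
  by case/orP=> [/pE|/qE].
- move=> i hi; rewrite (walk_nth hw hi); case: ltnP => hi'.
    by rewrite modn_small.
  have -> : i.+1 = size (k :: p ++ q) by apply/eqP; rewrite eqn_leq hi hi'.
  by rewrite modnn.
(* The final state follows [p], hence is the source of the first transition of [q]; if [q] is empty
   it is the source of [k]. *)
- case: q hq {qE hw} => [|k' q] /=.
    by move=> /eqP e; exists 0 => //=; rewrite -e.
  case/andP=> /eqP e _; exists (size p).+1; first by rewrite /= size_cat /= ltnS
    addnS ltnS leq_addr.
  by rewrite /= nth_cat ltnn subnn /= e.
Qed.

(** * From a live set of transitions to a fair computation *)

Section Backward.
Variable E : nat -> bool.
Hypothesis live : live_edges N E.
Variable k0 : nat.
Hypotheses (k0m : k0 < m) (k0E : E k0).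

Definition cyc (k : nat) : seq nat := epsilon (inhabits [::]) (lasso E k).

Lemma cycP k : k < m -> E k -> lasso E k (cyc k).
Proof.
move=> hk hE; apply: (epsilon_spec (inhabits [::]) (lasso E k)); apply: exists_lasso
  => //.
by have [] := live hk hE.
Qed.

Definition width : nat := \max_(k < m) size (cyc k).
(** A transition together with an offset into its closed walk. All walks share the range ['I_width],
    which avoids a dependent type; on shorter walks the offsets wrap around and merely duplicate
    clients. *)
Definition client : finType := ({k : 'I_m | E k} * 'I_width)%type.

Definition ed (y : client) (r : nat) : nat :=
  nth 0 (cyc (val (val y.1))) ((y.2 + r) %% size (cyc (val (val y.1)))).

Lemma clientP (y : client) : lasso E (val (val y.1)) (cyc (val (val y.1))).
Proof. by case: y => [[k hk] o]; apply: cycP hk. Qed.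

Lemma ed_live y r : ed y r < m /\ E (ed y r).
Proof. by have [h0 _ h _ _] := clientP y; apply: h; rewrite ltn_mod. Qed.

Lemma ed_next y r : t_dst (tr (ed y r)) = t_src (tr (ed y r.+1)).
Proof.
have [h0 _ _ h _] := clientP y; rewrite /ed h ?ltn_mod //.
by rewrite -addn1 modnDml addn1 addnS.
Qed.

Lemma ed_final y M : exists2 r, M <= r & t_src (tr (ed y r)) \in bfin N.
Proof.
have [h0 _ _ _ [o ho hf]] := clientP y; rewrite /ed.
set s := size _ in h0 ho *.
have hs : y.2 <= s * y.2 by rewrite leq_pmull.
(* The term [s * y.2 - y.2] cancels the offset of [y] modulo [s], leaving position [o]; the term
   [M * s] makes the round late. *)
exists (M * s + (s * y.2 - y.2) + o).
  by rewrite -addnA (leq_trans (leq_pmulr M h0)) // leq_addr.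
have -> : y.2 + (M * s + (s * y.2 - y.2) + o) = (M + y.2) * s + o by rewrite mulnDl
  (mulnC _ s) (mulnC y.2); lia.
by rewrite modnMDl modn_small.
Qed.

(** In every round all of [E] is in use: the client on the walk of [k] whose offset is [- r] modulo
    the length of the walk is back at its start. *)
Lemma ed_at k r : k < m -> E k -> exists y, ed y r = k.
Proof.
move=> hk hE; have [h0 e0 _ _ _] := cycP hk hE.
set s := size (cyc k) in h0.
have hw : (s - r %% s) %% s < width.
  apply: leq_trans (_ : s <= _); first by rewrite ltn_mod.
  exact: (@leq_bigmax _ (fun k : 'I_m => size (cyc k)) (Ordinal hk)).
exists (exist _ (Ordinal hk) hE, Ordinal hw); rewrite /ed /= -/s modnDml.
by rewrite -modnDmr subnK ?modnn // ltnW // ltn_mod.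
Qed.

Lemma ed_sender y r : ~~ t_send (tr (ed y r)) ->
  exists y', t_send (tr (ed y' r)) /\ t_msg (tr (ed y' r)) = t_msg (tr (ed y r)).
Proof.
move=> hs; have [hm hE] := ed_live y r.
have [_ [/(_ hs) [j [hj Ej sj mj]] _]] := live hm hE.
by have [y' e] := ed_at r hj Ej; exists y'; rewrite e.
Qed.

(* In round [r] every client [y] moves once, along edge [ed y r]; [D] collects
   the clients that have already moved. *)
Definition status : Type := (nat * {set client})%type.

Definition sender (z : status) : option client :=
  [pick y | (y \notin z.2) && t_send (tr (ed y z.1))].

Definition movers (r : nat) (D : {set client}) (y : client) : {set client} :=
  y |: [set y' | [&& y' \notin D, ~~ t_send (tr (ed y' r)) &
                     t_msg (tr (ed y' r)) == t_msg (tr (ed y r))]].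

Definition advance (z : status) : status :=
  if sender z is Some y then
    let D := z.2 :|: movers z.1 z.2 y in
    if D == setT then (z.1.+1, set0) else (z.1, D)
  else z.

(** The state after a move is given as the source of the next transition; [ed_next] identifies it
    with the target of the one taken. *)
Definition states (z : status) (y : client) : nat :=
  t_src (tr (ed y (if y \in z.2 then z.1.+1 else z.1))).

(** Invariant of a round: every waiting receiver still has a waiting sender. It survives a broadcast
    because all waiting receivers of that message move with it, and the senders of other messages
    stay put. *)
Definition sound (z : status) : Prop :=
  z.2 != setT /\ forall y, y \notin z.2 -> ~~ t_send (tr (ed y z.1)) ->
    exists2 y', y' \notin z.2 &
      t_send (tr (ed y' z.1)) /\ t_msg (tr (ed y' z.1)) = t_msg (tr (ed y z.1)).

Lemma client0 : exists y : client, True.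
Proof. by have [y _] := ed_at 0 k0m k0E; exists y. Qed.

Lemma sound_start r : sound (r, set0).
Proof.
split.
  have [y _] := client0; apply/eqP => /setP /(_ y); by rewrite !inE.
by move=> y _ /ed_sender [y' h]; exists y'; rewrite ?inE.
Qed.

Lemma sound_sender z : sound z -> exists2 y, sender z = Some y &
  (y \notin z.2) && t_send (tr (ed y z.1)).
Proof.
move=> [h1 h2]; rewrite /sender; case: pickP => [y hy|hn]; first by exists y.
have [y] : exists y, y \notin z.2.
  apply/existsP; rewrite -negb_forall; apply: contra h1 => /forallP h.
  by apply/eqP/setP => y; rewrite !inE; apply: h.
move=> hy; have := hn y; rewrite /= hy /= => /negbT /(h2 y hy) [y' hy' [hs _]].
by have := hn y'; rewrite /= hy' hs.
Qed.

Lemma sound_advance z : sound z -> sound (advance z).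
Proof.
move=> hz; have [y ey /andP[hy hs]] := sound_sender hz; rewrite /advance ey.
case: ifPn => hD; first exact: sound_start.
split=> //= y1; rewrite !inE !negb_or => /and3P[h1 h2 h3] h4.
have [y' hy' [h5 h6]] := hz.2 _ h1 h4.
exists y'; last by [].
rewrite !inE !negb_or hy' h5 andbF andbT /=.
by apply: contraNneq h3 => <-; rewrite h1 h4 h6 eqxx.
Qed.

Lemma sound_step z : sound z -> exists a T, gstep (states z) (states (advance z)) a T.
Proof.
move=> hz; have [y ey /andP[hy hs]] := sound_sender hz.
exists (t_msg (tr (ed y z.1))), (movers z.1 z.2 y).
have st y' : states (advance z) y' = t_src (tr (ed y' (if y' \in z.2 :|: movers z.1
  z.2 y then z.1.+1 else z.1))).
  by rewrite /states /advance ey; case: eqP => [->|//]; rewrite !inE.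
have hd y' : (t_src (tr (ed y' z.1)), t_send (tr (ed y' z.1)), t_msg (tr (ed y'
  z.1)), t_src (tr (ed y' z.1.+1))) \in bdelta N.
  by rewrite -ed_next -tr_eta; apply: tr_mem; case: (ed_live y' z.1).
exists y; split.
- by rewrite !inE eqxx.
- have := hd y; rewrite hs st /states (negbTE hy) /=.
  by rewrite !inE eqxx orbT.
- move=> y' hy' ne; have := hd y'; rewrite st /states inE hy' orbT /=.
  move: hy'; rewrite !inE (negbTE ne) /= => /and3P[/negbTE -> /negbTE -> /eqP ->];
    exact.
- by move=> y' hy'; rewrite st /states inE (negbTE hy') orbF.
Qed.

Definition round (j : nat) : status := iter j advance (0, set0).

Lemma sound_round j : sound (round j).
Proof. by elim: j => [|j IH]; [apply: sound_start|apply: sound_advance]. Qed.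

(** A late round can begin only at a late step, so final states visited in late rounds are visited
    late in the computation. *)
Lemma round_le j : (round j).1 <= j.
Proof.
elim: j => [|j IH] //=; rewrite {1}/advance.
case: (sender _) => [y|]; last exact: leqW.
by case: ifP => _ //=; apply: leqW.
Qed.

(** Each broadcast moves at least its sender, so the number of waiting clients decreases. *)
Lemma finish_round z : sound z -> exists j, iter j advance z = (z.1.+1, set0).
Proof.
have [b] := ubnP #|~: z.2|; elim: b z => // b IH z hb hz.
have [y ey /andP[hy hs]] := sound_sender hz.
case: (boolP (z.2 :|: movers z.1 z.2 y == setT)) => hD.
  by exists 1; rewrite /= /advance ey hD.
have e : advance z = (z.1, z.2 :|: movers z.1 z.2 y) by rewrite /advance ey (negbTE hD).
have [||j hj] := IH (advance z).
- rewrite e /=; rewrite ltnS in hb; apply: leq_trans hb.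
  apply: proper_card; apply/properP; split; first by rewrite setCS subsetUl.
  by exists y; rewrite !inE // eqxx orbT.
- exact: sound_advance.
by exists j.+1; rewrite iterSr hj e.
Qed.

Lemma round_start r : exists j, round j = (r, set0).
Proof.
elim: r => [|r [j hj]]; first by exists 0.
have [i hi] := finish_round (sound_start r).
by exists (i + j); rewrite /round iterD -/(round j) hj.
Qed.

Lemma computation_of_live_edges : fair_live N.
Proof.
have [y0 _] := client0.
have hreach y : reach (t_src (tr (ed y 0))).
  by have [h1 h2] := ed_live y 0; case: (live h1 h2).
have [q0 hq0] := reach_binit (hreach y0).
have [|Z [f [c0 [c [hi hr hf hc]]]]] := @coverable_seq q0 [seq t_src (tr (ed y 0)) |
  y <- enum client] hq0.
  by move=> q /mapP [y _ ->].
rewrite size_map -cardE in hf hc.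
pose F (y : client) := f (enum_rank y).
have injF : injective F by move=> y y' /hf e; apply/enum_rank_inj/val_inj/e; apply:
  ltn_ord.
have cF y : c (F y) = t_src (tr (ed y 0)).
  rewrite hc ?ltn_ord // (nth_map y) -?cardE ?ltn_ord //.
  by rewrite -enum_val_nth enum_rankK.
(* Members of the population outside the image of [F] were needed only to reach the starting states;
   they remain idle at [c z]. *)
pose lift (g : client -> nat) z := if [pick y | F y == z] is Some y then g y else c z.
have liftF g y : lift g (F y) = g y.
  by rewrite /lift; case: pickP => [y' /eqP/injF->//|/(_ y)]; rewrite eqxx.
have liftN g z : z \notin codom F -> lift g z = c z.
  by move=> hz; rewrite /lift; case: pickP => // y /eqP e; case/negP: hz; rewrite -e
    codom_f.
have [msg hmsg] : exists msg, forall j, exists T, gstep (states (round j)) (states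
  (round j.+1)) (msg j) T.
  pose P j a := exists T, gstep (states (round j)) (states (round j.+1)) a T.
  exists (fun j => epsilon (inhabits 0) (P j)) => j.
  exact: (epsilon_spec (inhabits 0) (P j) (sound_step (sound_round j))).
pose typ j := epsilon (inhabits set0) (gstep (states (round j)) (states (round j.+1))
  (msg j)).
have htyp j : gstep (states (round j)) (states (round j.+1)) (msg j) (typ j).
  by apply: (epsilon_spec (inhabits set0) (gstep _ _ _)); apply: hmsg.
apply: fair_live_of_finType hi _; apply: fair_from_run hr _.
exists (fun j => lift (states (round j))), msg, (fun j => [set F y | y in typ j]);
  split.
- move=> z; rewrite /lift; case: pickP => // y /eqP <-.
  by rewrite cF /states inE.
- move=> j; have [i [h1 h2 h3 h4]] := htyp j; exists (F i); split.
  + exact: imset_f.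
  + by rewrite !liftF.
  + move=> z /imsetP [y hy ->] ne; rewrite !liftF; apply: h3 => //.
    by apply: contraNneq ne => ->.
  + move=> z hz; case: (boolP (z \in codom F)) => [/codomP [y e]|hz']; last by
      rewrite !liftN.
    rewrite e !liftF; apply: h4; apply: contra hz => hy; rewrite e; exact: imset_f.
(* A member that moves at all is some [F y]. At the start of a round [r] given by [ed_final] nobody
   has moved yet, so its state is the source of [ed y r], which is final. *)
- move=> z hz M; have [j0 _ /imsetP [y _ ->]] := hz 0.
  have [r hr' hfin] := ed_final y M; have [j hj] := round_start r.
  exists j; first by apply: leq_trans hr' _; have := round_le j; rewrite hj.
  by rewrite liftF hj /states inE.
Qed.
End Backward.

Theorem fair_liveP : fair_live N <-> exists E, live_edges N E /\ exists2 k, k < m & E k.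
Proof.
split=> [[K [cfg [msg [typ [h1 h2 h3]]]]]|[E [hE [k hk Ek]]]].
  exact: live_edges_of_computation h1 h2 h3.

exact (computation_of_live_edges hE hk Ek).
Qed.
End Characterization.

(** * Polynomial time *)

Definition poly_bounded (f : instance -> nat) : Prop :=
  exists c e, forall N, f N <= c * (size (enc_instance N)).+1 ^ e.

Lemma poly_const b : poly_bounded (fun=> b).
Proof. by exists b, 0 => N; rewrite expn0 muln1. Qed.

Lemma poly_size : poly_bounded (fun N => size (enc_instance N)).
Proof. by exists 1, 1 => N; rewrite mul1n expn1. Qed.

Lemma poly_add f g :
  poly_bounded f -> poly_bounded g -> poly_bounded (fun N => f N + g N).
Proof.
move=> [c [e hf]] [c' [e' hg]]; exists (c + c'), (e + e') => N.
rewrite mulnDl; apply: leq_add; [apply: leq_trans (hf N) _|apply: leq_trans (hg N) _];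
  by rewrite leq_mul // leq_pexp2l // (leq_addr, leq_addl).
Qed.

Lemma poly_mul f g :
  poly_bounded f -> poly_bounded g -> poly_bounded (fun N => f N * g N).
Proof.
move=> [c [e hf]] [c' [e' hg]]; exists (c * c'), (e + e') => N.
by rewrite expnD mulnACA; apply: leq_mul.
Qed.

Lemma poly_succ f : poly_bounded f -> poly_bounded (fun N => (f N).+1).
Proof.
move=> /poly_add /(_ (poly_const 1)) [c [e h]]; exists c, e => N.
by rewrite -addn1.
Qed.

(** Building the blocks, plus one sweep forth and back for each executed instruction; a block has
    [w'.+1] bits, and the added 1 is the final [Look]. *)
Definition machine_time (N : instance) : nat :=
  let n := size (enc_instance N) in
  n * (2 * n * w'.+2 + 2 * w'.+1 + 8) + n * w'.+1 + 4 +
  (decide_time N + 1) * (2 * (n * w'.+1) + 2).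

Lemma poly_machine_time : poly_bounded machine_time.
Proof.
rewrite /machine_time /decide_time /parse_time /check_time /fix_time /edges_time.
repeat first [exact: poly_const | exact: poly_size | apply: poly_add
  | apply: poly_mul | apply: poly_succ].
Qed.

Theorem theorem2 : poly_time_decidable fair_live.
Proof.
have [c [e ht]] := poly_machine_time.
exists (compiled np w' program), c, e; split.
  by rewrite (inj_eq enum_rank_inj).
move=> N wfN x T.
have hi : inp x (store0 np x) by [].
have [t [s' [hex htime [gs hR]]]] := does_decide wfN hi.
have hrun := runs_seq_do (Look tR pZ) hex.
have [|h1 h2] := compiled_correct (isT : 0 < np) (isT : np < w'.+1) wf_program
  (n_gt0 N) hrun (T := T).
  apply: leq_trans (ht N); rewrite /machine_time leq_add2l leq_mul2r; apply/orP; right.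
  by rewrite leq_add2r.
split=> //; rewrite h2 (look_z _ gs : res _ (Look tR pZ) s' = _) fair_liveP.
exact: hR.
Qed.
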